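(* Let $P_1:=[0,1]^{2^{<\omega}}$ and let $C_1\subseteq P_1$ be the set $\mathcal P$ of everywhere converging martingales. Define inductively, for each natural number $n\geq1$: $P_{n+1}:=\mathcal C(2^\omega,P_n)$, the space of continuous functions from $2^\omega$ into $P_n$ equipped with the topology of uniform convergence; $C_{n+1}:=\{h\in P_{n+1}\mid\forall\beta\in2^\omega\ \ h(\beta)\notin C_n\}$; and $U_n:=\{(h,\beta)\in P_{n+1}\times2^\omega\mid h(\beta)\in C_n\}$. Then for every natural number $n\geq1$: (a) the set $U_n$ is uniformly $P_{n+1}$-universal for the ${\bf\Pi}^1_n$ subsets of $2^\omega$; (b) the set $C_n$ is ${\bf\Pi}^1_n$-complete.
   Context: $2^{<\omega}$ is the set of finite binary sequences, $2^\omega$ the Cantor space; for $\beta\in 2^\omega$, $\beta|l$ is the initial segment of $\beta$ of length $l$. The space $[0,1]^{2^{<\omega}}$ has the product topology. A martingale is a map $f:2^{<\omega}\to[0,1]$ such that $f(s)=\frac{f(s0)+f(s1)}{2}$ for each $s\in 2^{<\omega}$. A martingale $f$ is everywhere converging if $(f(\beta|l))_{l\in\omega}$ converges for every $\beta\in2^\omega$; $\mathcal P$ is the set of such martingales. Let ${\bf\Gamma}$ be a class of subsets of Polish spaces, $X,Y$ Polish spaces and $\mathcal U\subseteq Y\times X$; write $\mathcal U_y:=\{x\in X\mid(y,x)\in\mathcal U\}$. $\mathcal U$ is $Y$-universal for the ${\bf\Gamma}$ subsets of $X$ if $\mathcal U\in{\bf\Gamma}(Y\times X)$ and ${\bf\Gamma}(X)=\{\mathcal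 U_y\mid y\in Y\}$. $\mathcal U$ is uniformly $Y$-universal for the ${\bf\Gamma}$ subsets of $X$ if moreover, for each $S\in{\bf\Gamma}(\omega^\omega\times X)$, there is a Borel map $b:\omega^\omega\to Y$ such that $S_\alpha=\mathcal U_{b(\alpha)}$ for each $\alpha\in\omega^\omega$. A subset $C$ of a Polish space $X$ is ${\bf\Gamma}$-complete if $C\in{\bf\Gamma}(X)$ and for every zero-dimensional Polish space $Z$ and every $D\in{\bf\Gamma}(Z)$ there is a continuous $g:Z\to X$ with $D=g^{-1}(C)$. ${\bf\Pi}^1_n$ denotes the boldface projective classes. *)

(* Defs.v *)
From HB Require Import structures.
From mathcomp Require Import all_boot all_order all_algebra.
From mathcomp Require Import all_classical all_reals all_analysis.

Set Implicit Arguments.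
Unset Strict Implicit.
Unset Printing Implicit Defensive.

Import Order.TTheory GRing.Theory Num.Theory.
Import numFieldNormedType.Exports.

Local Open Scope classical_set_scope.
Local Open Scope ring_scope.

Definition baire_space : topologicalType := prod_topology (fun _ : nat => nat).

Definition separable (T : topologicalType) :=
  exists2 D : set T, countable D & dense D.

Definition completely_metrizable (R : realType) (T : topologicalType) :=
  exists (M : metricType R) (f : T -> M) (g : M -> T),
    [/\ cancel f g, cancel g f, continuous f & continuous g] /\
    forall F : set_system M, ProperFilter F -> cauchy F -> exists x : M, F --> x.

Definition polish (R : realType) (T : topologicalType) :=
  separable T /\ completely_metrizable R T.

(* The library's [zero_dimensional] only asks that clopen sets separate points,
   which is strictly weaker for Polish spaces (complete Erdos space). *)
Definition has_clopen_basis (T : topologicalType) :=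
  basis [set U : set T | clopen U].

Definition borel (T : topologicalType) : set (set T) := <<s [set U | open U] >>.

Definition borel_map (T1 T2 : topologicalType) (f : T1 -> T2) :=
  forall V : set T2, borel V -> borel (f @^-1` V).

Definition pointclass := forall X : topologicalType, set (set X).

Definition projections (G : pointclass) : pointclass :=
  fun X A => exists2 B : set (X * baire_space), G _ B & A = fst @` B.

Definition dual_class (G : pointclass) : pointclass := fun X A => G X (~` A).

(* [Pi1 n] is boldface Pi^1_n for n >= 1: its members are the complements of
   projections along the Baire space of closed sets if n = 1, and of
   Pi^1_(n-1) sets if n > 1.  The value at 0 only starts the recursion. *)
Fixpoint Pi1 (n : nat) : pointclass :=
  if n is m.+1 then dual_class (projections (Pi1 m))
  else fun X => [set A : set X | closed A].

Section universal_complete.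
Variables (R : realType) (G : pointclass).

Definition universal (Y X : topologicalType) (U : set (Y * X)) :=
  [/\ polish R Y, polish R X, G U & @G X = range (xsection U)].

Definition uniformly_universal (Y X : topologicalType) (U : set (Y * X)) :=
  universal U /\
  forall S : set (baire_space * X), G S ->
    exists2 b : baire_space -> Y, borel_map b &
      forall a : baire_space, xsection S a = xsection U (b a).

Definition class_complete (X : topologicalType) (C : set X) :=
  [/\ polish R X, G C &
    forall Z : topologicalType, polish R Z -> has_clopen_basis Z ->
      forall D : set Z, G D ->
        exists2 g : Z -> X, continuous g & D = g @^-1` C].

End universal_complete.

Section martingales.
Variable R : realType.

Definition unit_itv : uniformType := set_type (`[0, 1]%classic : set R).

Definition tree_functions : uniformType :=
  prod_topology (fun _ : seq bool => unit_itv).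

Definition martingale (f : tree_functions) :=
  forall s : seq bool,
    \val (f s) = (\val (f (rcons s false)) + \val (f (rcons s true))) / 2.

Definition everywhere_converging (f : tree_functions) :=
  forall beta : cantor_space, cvgn (fun l => \val (f (mkseq beta l)) : R).

(* The indices are shifted by one: [Pspace n], [Cset n] and [Uset n] are the spaces and
   sets numbered n + 1 when counting starts at 1. *)
Fixpoint Pspace (n : nat) : uniformType :=
  if n is m.+1 then
    initial_topology
      (id : continuousType cantor_space (Pspace m) ->
            arrow_uniform_type cantor_space (Pspace m))
  else tree_functions.

Fixpoint Cset (n : nat) : set (Pspace n) :=
  match n with
  | 0 => [set f : tree_functions | martingale f /\ everywhere_converging f]
  | m.+1 => [set h : continuousType cantor_space (Pspace m) |
              forall beta : cantor_space, ~ Cset (h beta)]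
  end.

Definition Uset (n : nat) : set (Pspace n.+1 * cantor_space) :=
  [set hb | Cset ((hb.1 : continuousType cantor_space (Pspace n)) hb.2)].

End martingales.

(* Main.v *)
(** For z in a zero-dimensional Polish space Z, a Pi^1_1 set D is the set of z
    whose tree T_z on the natural numbers has no infinite branch, where T_z
    depends continuously on z.  A tree T is turned into a martingale by an
    automaton reading finite binary words: it decodes a word as a node of T, and
    the value alternates between 1/2 and 3/4 along the nodes of T, each step
    being compensated on a sibling where the martingale becomes constant.  It
    oscillates exactly along the infinite branches of T, so C_1 is complete.

    The reduction of a Pi^1_(n+1) set D to C_(n+1) is obtained from a reduction
    to C_n.  If the complement of D is the projection of a Pi^1_n set B in
    Z x omega^omega, elements of omega^omega are coded by elements of 2^omega
    without leaving Pi^1_n; the coded set has a reduction g to C_n, defined on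
    Z x 2^omega, and its currying z |-> g(z, .) is continuous since 2^omega is
    compact.  Currying a reduction defined on omega^omega x 2^omega in the same
    way yields the uniform universality of U_n. *)
From HB Require Import structures.
Require Import Defs.
From mathcomp Require Import all_boot all_order all_algebra.
From mathcomp Require Import all_classical all_reals all_analysis.
From mathcomp Require Import lra.

Set Implicit Arguments.
Unset Strict Implicit.
Unset Printing Implicit Defensive.

Import Order.TTheory GRing.Theory Num.Theory.
Import numFieldNormedType.Exports.

Local Open Scope classical_set_scope.
Local Open Scope ring_scope.

(** * Metrization *)

Section metrization.
Context {R : realType} {T : uniformType} (cT : countable_uniformity T).
Hypothesis hT : hausdorff_space T.

Let P := @countable_uniform T cT.
(* The disjunct [1 <= e] keeps this set nonempty for all x and y. *)
Let dset (x y : P) : set R := [set e | 0 < e /\ (ball x e y \/ 1 <= e)].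
Let dist (x y : P) : R := inf (dset x y).

Let dset1 x y : dset x y 1. Proof. by split => //; right. Qed.

Let dset_inf x y : has_inf (dset x y).
Proof. by split; [exists 1|exists 0 => e [/ltW]]. Qed.

Let dist_ge0 x y : 0 <= dist x y.
Proof. by apply: lb_le_inf; [exists 1|move=> e [/ltW]]. Qed.

Let dist_lt x y e : e <= 1 -> dist x y < e -> ball x e y.
Proof.
move=> e1 /(inf_lt (dset_inf x y).1 )[e' [e'0 +] e'e]; case=> [xy|].
  by apply: le_ball xy; exact: ltW.
by move=> e'1; have := le_lt_trans e'1 e'e; rewrite ltNge e1.
Qed.

Let dist_le x y e : 0 < e -> ball x e y -> dist x y <= e.
Proof. by move=> e0 xy; apply: ge_inf; [exact: (dset_inf x y).2|split;
  [|left]]. Qed.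

Let distxx x : dist x x = 0.
Proof.
apply/eqP; rewrite eq_le dist_ge0 andbT; apply/ler_addgt0Pl => e e0.
by rewrite addr0; apply: dist_le => //; exact: ballxx.
Qed.

Let dist_pos x y : dist x y = 0 -> x = y.
Proof.
move=> xy0; apply: hT => A B; rewrite -!nbhs_entourageE.
move=> -[E /= entE EA] [F entF FB].
have : @entourage P (E `&` F) by apply: (@filterI _ (@entourage P)).
rewrite -(@entourage_ballE R P) => -[e /= e0 eEF].
exists y; split; last by apply/FB/mem_set; exact: entourage_refl.
apply/EA/mem_set.
have m0 : 0 < Num.min e 1 by rewrite lt_min e0 ltr01.
have : ball x (Num.min e 1) y by apply: dist_lt;
  rewrite ?xy0// ge_min lexx orbT.
by move/(@le_ball _ _ x _ e); rewrite ge_min lexx => /(_ isT) /(eEF (_, _))[].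
Qed.

Let dist_sym x y : dist x y = dist y x.
Proof.
by congr inf; apply/seteqP; split => e [e0 [|]]; split => //;
  [left; exact: ball_sym|right|left; exact: ball_sym|right].
Qed.

Let dist_triangle y x z : dist x z <= dist x y + dist y z.
Proof.
apply/ler_addgt0Pl => e e0.
have e20 : 0 < e / 2 by rewrite divr_gt0.
have [|a [a0 xa] ha] := @inf_lt _ _ (dist x y + e / 2) (dset_inf x y).1.
  by rewrite ltrDl.
have [|b [b0 yb] hb] := @inf_lt _ _ (dist y z + e / 2) (dset_inf y z).1.
  by rewrite ltrDl.
apply: (@le_trans _ _ (a + b)); last first.
  rewrite [e]splitr [leRHS]addrACA ![e / 2 + _]addrC.
  by apply: lerD; exact: ltW.
apply: ge_inf; first exact: (dset_inf x z).2.
split; first exact: addr_gt0.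
case: xa => [xa|a1]; last by right; rewrite (le_trans a1)// lerDl ltW.
case: yb => [yb|b1]; last by right; rewrite (le_trans b1)// lerDr ltW.
by left; exact: ball_triangle xa yb.
Qed.

(** The [let] keeps [hT] in the type, where the metric instance declared below finds it in order to
    separate points. *)
Definition metrized : Type := let _ := hT in countable_uniform cT.
HB.instance Definition _ := Choice.copy metrized T.
HB.instance Definition _ :=
  @isMetric.Build R metrized dist distxx dist_pos dist_sym dist_triangle.

(** The balls of [P] and those of the metric refine each other. The agreement is uniform, not only
    topological, so Cauchy filters and completeness carry over. *)
Lemma metrized_entourage : @entourage metrized = @entourage T.
Proof.
transitivity (@entourage P); last by [].
rewrite -(@entourage_ballE R P) -(@entourage_ballE R metrized).
apply/seteqP; split => E [e /= e0 eE].
  (* [dist_le] yields a weak inequality; halving [e] makes it strict. *)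
  exists (e / 2) => /=; first by rewrite divr_gt0.
  move=> [x y] /= xy; apply: eE => /=; rewrite ballEmdist /=.
  by rewrite (@le_lt_trans _ _ (e / 2))// ?dist_le// ?divr_gt0// ltr_pdivrMr//
    ltr_pMr// ltr1n.
exists (Num.min e 1) => /=; first by rewrite lt_min e0 ltr01.
move=> [x y] /=; rewrite ballEmdist /= => xy; apply: eE => /=.
have m1 : Num.min e 1 <= 1 :> R by rewrite ge_min lexx orbT.
have me : Num.min e 1 <= e :> R by rewrite ge_min lexx.
exact: (@le_ball R P x _ _ me _ (dist_lt m1 xy)).
Qed.

Lemma metrized_nbhs : @nbhs _ metrized = @nbhs _ T.
Proof. by rewrite -!nbhs_entourageE metrized_entourage. Qed.

End metrization.

Definition uniformly_complete (T : uniformType) :=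
  forall F : set_system T, ProperFilter F -> cauchy F -> exists x : T, F --> x.

Lemma completely_metrizable_uniform (R : realType) (T : uniformType) :
  countable_uniformity T -> hausdorff_space T -> uniformly_complete T ->
  completely_metrizable R T.
Proof.
move=> cT hT compT; exists (@metrized T cT hT), id, id; split;
  first split => //.
- by move=> x A; rewrite /= (@metrized_nbhs R T cT hT).
- by move=> x A; rewrite /= -(@metrized_nbhs R T cT hT).
move=> F PF Fc; have [|x Fx] := compT F PF; first by move=> E;
  rewrite -(@metrized_entourage R T cT hT) => /Fc.
by exists x => A; rewrite (@metrized_nbhs R T cT hT) => /Fx.
Qed.

(** * Polish uniform spaces *)

Section initial_uniformity.
Context {S : choiceType} {U : uniformType} (f : S -> U).
Let W := initial_topology f.

Lemma initial_cvg (F : set_system W) (s : W) :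
  Filter F -> f @ F --> f s -> F --> s.
Proof.
move=> FF fF A [_ [[V oV <-] Vs VA]].
by apply: filterS VA _; apply: fF; exact: open_nbhs_nbhs.
Qed.

Lemma initial_countable_uniformity :
  countable_uniformity U -> countable_uniformity W.
Proof.
move=> /countable_uniformityP[g gE ge]; apply/countable_uniformityP.
exists (fun n => [set xy | g n (f xy.1, f xy.2)]); last by move=> n;
  exists (g n).
move=> A [B /gE[n gnB] BA]; exists n; apply: subset_trans BA.
by move=> xy; exact: gnB.
Qed.

Lemma initial_hausdorff : injective f -> hausdorff_space U -> hausdorff_space W.
Proof.
move=> fI hU x y xy; apply: fI; apply: hU => A B /= Ax By.
have [||s [As Bs]] := xy (f @^-1` A) (f @^-1` B); last by exists (f s).
  exact: (@initial_continuous _ _ f x _ Ax).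
exact: (@initial_continuous _ _ f y _ By).
Qed.

(** The second hypothesis says that the range of [f] is closed under limits. It is applied to the
    interval inside the line and to continuous functions among all functions. *)
Lemma initial_uniformly_complete : uniformly_complete U ->
  (forall (F : set_system W) (u : U), ProperFilter F -> f @ F --> u ->
    exists s, f s = u) ->
  uniformly_complete W.
Proof.
move=> cU cl F PF Fc.
have [E entE|u Fu] := cU (f @ F).
  have : entourage ([set xy | E (f xy.1, f xy.2)] : set (W * W)) by exists E.
  by move=> /Fc [[P Q] [/= FP FQ] PQ]; exists (f @` P, f @` Q);
    [split; [apply: filterS FP|apply: filterS FQ] => s ?; exists s
    |move=> [_ _] [/= [s Ps <-] [t Qt <-]]; exact: (PQ (s, t))].
have [s su] := cl F u PF Fu; exists s; apply: initial_cvg; by rewrite su.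
Qed.

End initial_uniformity.

(** An enumeration, unlike a dense set, lets finitely many approximations be coded by natural
    numbers. *)
Definition dense_sequence (T : topologicalType) (e : nat -> T) :=
  forall (x : T) (A : set T), nbhs x A -> exists n, A (e n).

Lemma dense_sequence_separable (T : topologicalType) (e : nat -> T) :
  dense_sequence e -> separable T.
Proof.
move=> de; exists (range e); first exact: card_image_le.
move=> O [x Ox] oO; have [|n On] := de x O; first exact: open_nbhs_nbhs.
by exists (e n); split => //; exists n.
Qed.

Definition polish_uniform (T : uniformType) :=
  [/\ countable_uniformity T, hausdorff_space T, uniformly_complete T
    & separable T].

Lemma polish_uniform_polish (R : realType) (T : uniformType) :
  polish_uniform T -> polish R T.
Proof.
by move=> [cT hT compT sT]; split => //; exact: completely_metrizable_uniform.
Qed.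

Section product.
Variables U V : uniformType.

Lemma prod_countable_uniformity : countable_uniformity U ->
  countable_uniformity V -> countable_uniformity (U * V)%type.
Proof.
move=> /countable_uniformityP[f fE fe] /countable_uniformityP[g gE ge].
apply/countable_uniformityP.
exists (fun n => let p := odflt (0, 0)%N (unpickle n) in
  [set xy | f p.1 (xy.1.1, xy.2.1) /\ g p.2 (xy.1.2, xy.2.2)]); last first.
  by move=> n; exact: prod_entP.
move=> A [[B C] /= [/fE[n nB] /gE[m mC]] BCA]; exists (pickle (n, m)).
rewrite pickleK /= => -[[a b] [c d]] /= [ac bd].
have [|[[a' c'] [b' d']] A' [<- <- <- <-]//] := BCA ((a, c), (b, d)).
by split; [exact: nB|exact: mC].
Qed.

Lemma prod_hausdorff : hausdorff_space U -> hausdorff_space V ->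
  hausdorff_space (U * V)%type.
Proof.
move=> hU hV [a b] [c d] cl; congr pair.
  apply: hU => A B Aa Bc.
  have [||[x y] [Ax Bx]] := cl (A `*` setT) (B `*` setT); last by exists x;
    split; [exact: Ax.1|exact: Bx.1].
    by exists (A, setT) => //=; split => //; exact: filterT.
  by exists (B, setT) => //=; split => //; exact: filterT.
apply: hV => A B Aa Bc.
have [||[x y] [Ax Bx]] := cl (setT `*` A) (setT `*` B); last by exists y;
  split; [exact: Ax.2|exact: Bx.2].
  by exists (setT, A) => //=; split => //; exact: filterT.
by exists (setT, B) => //=; split => //; exact: filterT.
Qed.

Lemma prod_uniformly_complete : uniformly_complete U -> uniformly_complete V ->
  uniformly_complete (U * V)%type.
Proof.
move=> cU cV F PF Fc.
have [E entE|u Fu] := cU (fst @ F).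
  have [[P Q] [/= FP FQ] PQ] := Fc _ (prod_entP entE (@entourageT V)).
  exists (fst @` P, fst @` Q) => /=.
    by split; [apply: filterS FP|apply: filterS FQ] => p ?; exists p.
  by move=> [_ _] [/= [p Pp <-] [q Qq <-]]; have [] := PQ (p, q).
have [E entE|v Fv] := cV (snd @ F).
  have [[P Q] [/= FP FQ] PQ] := Fc _ (prod_entP (@entourageT U) entE).
  exists (snd @` P, snd @` Q) => /=.
    by split; [apply: filterS FP|apply: filterS FQ] => p ?; exists p.
  by move=> [_ _] [/= [p Pp <-] [q Qq <-]]; have [] := PQ (p, q).
exists (u, v) => A [[P Q] [/= uP vQ] PQA].
have FP : F (fst @^-1` P) by exact: Fu.
have FQ : F (snd @^-1` Q) by exact: Fv.
by apply: filterS (filterI FP FQ) => -[a b] [Pa Qb]; exact: PQA.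
Qed.

End product.

Lemma prod_separable (U V : topologicalType) : separable U -> separable V ->
  separable (U * V)%type.
Proof.
move=> [D cD dD] [E cE dE]; exists (D `*` E); first exact: countableX.
move=> O [[x y] Oxy] oO; have : nbhs (x, y) O by exact: open_nbhs_nbhs.
move=> [[A B] [/=]]; rewrite !nbhsE => -[A' [oA A'x] A'A] [B' [oB B'y] B'B] ABO.
have [|a [A'a Da]] := dD A' _ oA; first by exists x.
have [|b [B'b Eb]] := dE B' _ oB; first by exists y.
by exists (a, b); split; [apply: ABO; split; [exact: A'A|exact: B'B]|].
Qed.

Lemma prod_polish_uniform (U V : uniformType) : polish_uniform U ->
  polish_uniform V -> polish_uniform (U * V)%type.
Proof.
move=> [? ? ? ?] [? ? ? ?]; split.
- exact: prod_countable_uniformity.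
- exact: prod_hausdorff.
- exact: prod_uniformly_complete.
- exact: prod_separable.
Qed.

(** * Countable powers *)

Definition lookup (I : eqType) (s : seq (I * nat)) (i : I) : nat :=
  head 0%N [seq p.2 | p <- s & p.1 == i].

Lemma lookup_map (I : eqType) (m : I -> nat) (l : seq I) (i : I) :
  i \in l -> lookup [seq (j, m j) | j <- l] i = m i.
Proof.
rewrite /lookup; elim: l => //= a l IH; rewrite inE => /predU1P[<-|il].
  by rewrite eqxx.
by case: ifP => /= [/eqP->//|_]; exact: IH.
Qed.

Section countable_power.
Context {I : countType} {K : uniformType}.
Let T : uniformType := prod_topology (fun _ : I => K).

Lemma prod_topology_cvg (F : set_system T) (x : T) : Filter F ->
  (forall i, (fun f : T => f i) @ F --> x i) -> F --> x.
Proof.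
by move=> FF Fx; apply/cvg_sup => i; apply: initial_cvg; exact: Fx.
Qed.

Lemma prod_topology_entourage (i : I) (E : set (K * K)) : entourage E ->
  entourage [set fg : T * T | E (fg.1 i, fg.2 i)].
Proof.
move=> entE.
have entE' : `[< @entourage (initial_topology (@proj _ (fun _ : I => K) i))
    [set fg | E (fg.1 i, fg.2 i)] >] by apply/asboolP; exists E.
exists [set fg : T * T | E (fg.1 i, fg.2 i)] => //.
refine (@finI_from1 _ _ setT _ (exist _ (i : {classic I}, _) entE') _). exact:
  Logic.I.
Qed.

Lemma power_countable_uniformity : countable_uniformity K ->
  countable_uniformity T.
Proof.
move=> cK; refine (@countable_sup_ent _ I
  (fun i => Uniform.class (initial_topology (@proj _ (fun _ : I => K) i))) _ _).
  exact: countableP.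
by move=> i; exact: initial_countable_uniformity.
Qed.

Lemma power_uniformly_complete : uniformly_complete K -> uniformly_complete T.
Proof.
move=> cK F PF Fc.
have lim i : exists y : K, (fun f : T => f i) @ F --> y.
  have [E entE|y Fy] := cK ((fun f : T => f i) @ F); last by exists y.
  have [[P Q] [/= FP FQ] PQ] := Fc _ (prod_topology_entourage i entE).
  exists ((fun f : T => f i) @` P, (fun f : T => f i) @` Q) => /=.
    by split; [apply: filterS FP|apply: filterS FQ] => p ?; exists p.
  by move=> [_ _] [/= [p Pp <-] [q Qq <-]]; have := PQ (p, q); exact.
have [x Fx] := choice lim; exists (x : T); exact: prod_topology_cvg.
Qed.

(** The dense points take finitely many prescribed values in [e] and the value [e 0] elsewhere. A
    sequence of them converges to [x] in every coordinate, so one of them lies in [A]. *)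
Lemma power_dense_sequence (e : nat -> K) : countable_uniformity K ->
  dense_sequence e -> exists g : nat -> T, dense_sequence g.
Proof.
move=> /countable_uniformityP[E EA Ee] de.
pose h (s : seq (I * nat)) : T := fun i => e (lookup s i).
exists (fun n => h (odflt [::] (unpickle n))) => x A xA.
(* The entourages [E j] need not decrease, hence all those of index below [k] are met at once. *)
have near_e k i : exists m, forall j, (j < k)%N -> E j (x i, e m).
  have : \forall y \near x i, forall j, (j < k)%N -> E j (x i, y).
    elim: k => [|k IH]; first exact: nearW.
    have := nbhs_entourage (x i) (Ee k); rewrite -nbhs_nearE => Ek.
    apply: filterS2 IH Ek => y yk /xsectionP ky j.
    by rewrite ltnS leq_eqVlt => /predU1P[->//|/yk].
  by move/de.
have /choice[m mP] : forall k, exists m : I -> nat,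
    forall i j, (j < k)%N -> E j (x i, e (m i)).
  by move=> k; have [m mP] := choice (near_e k); exists m.
(* Stage [k] prescribes the coordinates whose code is below [k]. *)
pose s k := [seq (i, m k i) | i <- pmap unpickle (iota 0 k)].
have hs k i : (pickle i < k)%N -> h (s k) i = e (m k i).
  move=> ik; rewrite /h /s lookup_map// mem_pmap; apply/mapP.
  by exists (pickle i); rewrite ?pickleK// mem_iota.
have hx : (fun k => h (s k)) @ \oo --> (x : T).
  apply: prod_topology_cvg => i B.
  rewrite -nbhs_entourageE => -[F entF FB].
  have [N NF] := EA F entF.
  exists (maxn (pickle i) N).+1 => //= k; rewrite /= gtn_max => /andP[ik Nk].
  by rewrite hs//; apply/FB/mem_set/NF/mP.
have [k Ak] := @filter_ex _ \oo _ ((fun k => h (s k)) @^-1` A) (hx _ xA);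
  exists (pickle (s k)).
by rewrite pickleK.
Qed.

End countable_power.

Section discrete.
Variable K : discreteUniformType.
Let T : uniformType := prod_topology (fun _ : nat => K).

Lemma discrete_countable_uniformity : countable_uniformity K.
Proof.
apply/countable_uniformityP; exists (fun=> range (fun x => (x, x))).
  by move=> A; rewrite uniform_discrete => dA; exists 0%N.
by move=> n; rewrite uniform_discrete => x.
Qed.

Lemma discrete_uniformly_complete : uniformly_complete K.
Proof.
move=> F PF Fc.
have [|[P Q] [/= FP FQ] PQ] := Fc (range (fun x => (x, x))).
  by rewrite uniform_discrete => x.
have [x [Px Qx]] := filter_ex (filterI FP FQ).
exists x; apply/discrete_cvg; apply: filterS FQ => y Qy.
by have [z _ [<- <-]] := PQ (x, y) (conj Px Qy).
Qed.

Lemma cylinder_nbhs (x : T) n :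
  nbhs x [set y : T | mkseq y n = mkseq x n].
Proof.
elim: n => [|n IH]; first by apply: (@filterS _ (nbhs x) _ setT) => //;
  exact: filterT.
have xn : nbhs x [set y : T | y n = x n].
  exact: (@proj_continuous _ (fun _ : nat => K) n x _ (discrete_set1 (x n :
    K))).
by apply: filterS2 IH xn => y /= yx yn; rewrite !mkseqS yx yn.
Qed.

Lemma mkseq_eqP (X : Type) (x y : nat -> X) n :
  mkseq x n = mkseq y n <-> forall i, (i < n)%N -> x i = y i.
Proof.
split=> [xy i ni|xy]; last first.
  by apply/eq_in_map => i; rewrite mem_iota => /xy.
by rewrite -(nth_mkseq (x i) x ni) xy nth_mkseq.
Qed.

(** The filter generated by the cylinders around [x] converges to [x] in each coordinate, hence in
    the product. *)
Lemma nbhs_cylinder (x : T)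
    (A : set (T)) :
  nbhs x A -> exists n, [set y : T | mkseq y n = mkseq x n] `<=` A.
Proof.
pose F := filter_from [set: nat]
  (fun n => [set y : T | mkseq y n = mkseq x n]).
have FF : Filter F.
  apply: filter_from_filter; first by exists 0%N.
  move=> m n _ _; exists (maxn m n) => // y /mkseq_eqP yx.
  by split; apply/mkseq_eqP => i im; apply: yx; rewrite leq_max im ?orbT.
have Fx : F --> x.
  apply: prod_topology_cvg => i B /nbhs_singleton Bx.
  exists i.+1 => // y /mkseq_eqP yx; rewrite /= yx//.
by move=> /Fx[n _ nA]; exists n.
Qed.

Lemma locally_constant_continuous (Y : topologicalType) n
    (f : T -> Y) :
  (forall x y, mkseq x n = mkseq y n -> f x = f y) -> continuous f.
Proof.
move=> fn x A /nbhs_singleton Afx.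
by apply: filterS (cylinder_nbhs x n) => y /fn fyx; rewrite /= fyx.
Qed.

End discrete.

Lemma nat_dense_sequence : dense_sequence (id : nat -> nat).
Proof. by move=> x A /nbhs_singleton Ax; exists x. Qed.

Lemma bool_dense_sequence : dense_sequence odd.
Proof. by move=> x A /nbhs_singleton Ax; exists x; case: x Ax. Qed.

Lemma power_polish_uniform (I : countType) (K : uniformType) (e : nat -> K) :
  countable_uniformity K -> hausdorff_space K -> uniformly_complete K ->
  dense_sequence e ->
  polish_uniform (prod_topology (fun _ : I => K)).
Proof.
move=> cK hK compK de; split.
- exact: power_countable_uniformity.
- exact: hausdorff_product.
- exact: power_uniformly_complete.
- by have [g /dense_sequence_separable] := @power_dense_sequence I K e cK de.
Qed.

Lemma baire_polish_uniform : polish_uniform (prod_topology (fun _ : nat =>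
  nat)).
Proof.
apply: (power_polish_uniform _ _ _ _ nat_dense_sequence).
- exact: discrete_countable_uniformity.
- exact: discrete_hausdorff.
- exact: discrete_uniformly_complete.
Qed.

Lemma cantor_polish_uniform : polish_uniform cantor_space.
Proof.
apply: (power_polish_uniform _ _ _ _ bool_dense_sequence).
- exact: discrete_countable_uniformity.
- exact: discrete_hausdorff.
- exact: discrete_uniformly_complete.
Qed.

(** * The unit interval *)

Section unit_interval.
Variable R : realType.

Lemma unit_itv_countable_uniformity : countable_uniformity (unit_itv R).
Proof.
by apply: initial_countable_uniformity; exact: countable_uniformity_metric.
Qed.

Lemma unit_itv_hausdorff : hausdorff_space (unit_itv R).
Proof. by apply: initial_hausdorff; [exact: val_inj|exact: Rhausdorff]. Qed.

Lemma unit_itv_uniformly_complete : uniformly_complete (unit_itv R).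
Proof.
apply: initial_uniformly_complete => [F PF Fc|F u PF Fu].
  by have /cvg_ex[x Fx] := @cauchy_cvg R F PF Fc; exists x.
have u01 : (`[0, 1]%classic : set R) u.
  apply: (@closed_cvg _ R F PF _ _ (@itv_closed _ R 0 1) _ u Fu).
  by apply: nearW => x; exact: set_valP.
by exists (exist _ u (mem_set u01)).
Qed.

Lemma clamp_proof (x : R) :
  Num.max 0 (Num.min 1 x) \in (`[0, 1]%classic : set R).
Proof.
by rewrite inE /= in_itv /= le_max lexx /= ge_max ler01 ge_min lexx.
Qed.

(** A continuous retraction of the line onto the interval; it carries the rationals to a dense
    sequence. *)
Definition clamp (x : R) : unit_itv R :=
  exist (fun y => y \in (`[0, 1]%classic : set R)) _ (clamp_proof x).

Lemma clampK (x : unit_itv R) : clamp (\val x) = x.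
Proof.
apply: val_inj => /=; have := set_valP x; rewrite /= in_itv /= => /andP[x0 x1].
by rewrite (min_idPr x1) (max_idPr x0).
Qed.

Lemma clamp_continuous : continuous clamp.
Proof.
apply: continuous_comp_initial => x.
apply: (@continuous_max R R (cst 0) (cst 1 \min id)); first exact: cvg_cst.
by apply: continuous_min; [exact: cvg_cst|exact: cvg_id].
Qed.

Lemma unit_itv_dense_sequence :
  dense_sequence (fun n => clamp (ratr (odflt 0 (unpickle n : option rat)))).
Proof.
move=> x A Ax; have : nbhs (\val x) (clamp @^-1` A).
  by apply: clamp_continuous; rewrite clampK.
rewrite nbhsE => -[B [oB Bx] BA].
have [|y [By [q _ qE]]] := @dense_rat R B _ oB; first by exists (\val x).
rewrite -qE in By.
by exists (pickle q); rewrite pickleK; exact: BA.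
Qed.

Lemma tree_functions_polish_uniform : polish_uniform (tree_functions R).
Proof.
apply: (power_polish_uniform _ _ _ _ unit_itv_dense_sequence).
- exact: unit_itv_countable_uniformity.
- exact: unit_itv_hausdorff.
- exact: unit_itv_uniformly_complete.
Qed.

End unit_interval.

(** * Maps on the Cantor space *)

Lemma pair_continuous (X Y Z : topologicalType) (f : X -> Y) (g : X -> Z) :
  continuous f -> continuous g -> continuous (fun x => (f x, g x)).
Proof.
move=> cf cg x A [[P Q] /= [fxP gxQ] PQA].
have fP : nbhs x (f @^-1` P) := cf x P fxP.
have gQ : nbhs x (g @^-1` Q) := cg x Q gxQ.
by apply: filterS2 fP gQ => y Pfy Qgy; exact: PQA.
Qed.

Lemma cantor_uniform_continuity (T : uniformType) (h : cantor_space -> T)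
    (E : set (T * T)) : continuous h -> entourage E ->
  exists n, forall x y : cantor_space, mkseq x n = mkseq y n -> E (h x, h y).
Proof.
move=> ch entE.
have /compact_near_coveringP cov := cantor_space_compact.
have [|n _ nP] := cov nat \oo
    (fun n x => forall y : cantor_space, mkseq x n = mkseq y n -> E (h x, h y))
      _.
  move=> x _.
  (* Both orientations are kept: the path goes from [h y] back to [h x] and then on to [h z]. *)
  have /ch := nbhs_entourage (h x) (entourage_invI (entourage_split_ent entE)).
  move=> /(@nbhs_cylinder bool)[k kP].
  exists ([set y : cantor_space | mkseq y k = mkseq x k], [set n | (k <= n)%N]).
    split; [exact: (@cylinder_nbhs bool)|by exists k].
  move=> [y n] /= [yx kn] z /mkseq_eqP yz.
  have /xsectionP[_ xy] := kP y yx.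
  have /xsectionP[xz _] : xsection (split_ent E `&` (split_ent E)^-1%relation)
    (h x) (h z).
    apply: (kP z); rewrite /= -yx; apply/mkseq_eqP => i ik.
    by rewrite yz// (leq_trans ik).
  exact: (entourage_split (h x)).
by exists n => x y; apply: (nP n (leqnn n)).
Qed.

Section arrow.
Context {X : choiceType} {U : uniformType}.
Let T := arrow_uniform_type X U.

Lemma arrow_countable_uniformity : countable_uniformity U ->
  countable_uniformity T.
Proof.
move=> /countable_uniformityP[g gE ge]; apply/countable_uniformityP.
exists (fun n => [set fg | forall t, g n (fg.1 t, fg.2 t)]).
  move=> A [B /gE[n nB] BA]; exists n; apply: subset_trans BA => fg fgn t.
  exact: nB.
by move=> n; exists (g n).
Qed.

Lemma arrow_hausdorff : hausdorff_space U -> hausdorff_space T.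
Proof.
move=> hU f g fg; apply/funext => t; apply: hU => A B.
rewrite -!nbhs_entourageE => -[E entE EA] [F entF FB].
have [||h [fh gh]] := fg [set h | forall t, E (f t, h t)] [set h | forall t, F
  (g t, h t)].
- rewrite -nbhs_entourageE; exists [set fg | forall t, E (fg.1 t, fg.2 t)].
    by exists E.
  by move=> h /xsectionP.
- rewrite -nbhs_entourageE; exists [set fg | forall t, F (fg.1 t, fg.2 t)].
    by exists F.
  by move=> h /xsectionP.
by exists (h t); split; [apply/EA/mem_set|apply/FB/mem_set].
Qed.

Lemma arrow_uniformly_complete : uniformly_complete U -> uniformly_complete T.
Proof.
move=> cU F PF Fc.
have lim t : exists y : U, (fun f : T => f t) @ F --> y.
  have [E entE|y Fy] := cU ((fun f : T => f t) @ F); last by exists y.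
  have [|[P Q] [/= FP FQ] PQ] := Fc [set fg | forall t, E (fg.1 t, fg.2 t)].
    by exists E.
  exists ((fun f : T => f t) @` P, (fun f : T => f t) @` Q) => /=.
    by split; [apply: filterS FP|apply: filterS FQ] => p ?; exists p.
  by move=> [_ _] [/= [p Pp <-] [q Qq <-]]; have := PQ (p, q); exact.
have [g Fg] := choice lim; exists (g : T).
apply/cvg_fct_entourageP => A entA.
have [|[P Q] [/= FP FQ] PQ] :=
  Fc [set fg | forall t, (split_ent A) (fg.1 t, fg.2 t)].
  by exists (split_ent A).
apply: filterS FQ => h Qh t.
have Ft : \forall f \near F, split_ent A (g t, f t).
  by have /cvg_entourageP := Fg t; exact.
have [f [Pf gf]] := filter_ex (filterI FP Ft).
exact: entourage_split gf (PQ (f, h) (conj Pf Qh) t).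
Qed.

End arrow.

(** Uniform limit theorem: one [h] in the filter is uniformly close to [u], and the path from [u x]
    to [u y] passes through [h x] and [h y]. *)
Lemma fct_limit_continuous (X : topologicalType) (U : uniformType)
    (F : set_system (continuousType X U)) (u : arrow_uniform_type X U) :
  ProperFilter F ->
  (fun h : continuousType X U => h : arrow_uniform_type X U) @ F --> u ->
  continuous (u : X -> U).
Proof.
move=> PF Fu x; apply/cvg_app_entourageP => A entA.
have entB := entourage_invI (entourage_split_ent (entourage_split_ent entA)).
have /cvg_fct_entourageP/(_ _ entB) Fh := Fu.
have [h uh] := @filter_ex _ F _ (fun h : continuousType X U => forall t,
  (split_ent (split_ent A) `&` (split_ent (split_ent A))^-1%relation)
  (u t, h t)) Fh.
have /cvg_app_entourageP/(_ _ (entourage_split_ent (entourage_split_ent entA)))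
  := @cts_fun _ _ h x.
apply: filterS => y hxy.
have [ux _] := uh x; have [_ uy] := uh y.
apply: (entourage_split (h x)) => //.
  by apply: split_ent_subset => //; exact: entourage_split_ent.
exact: entourage_split hxy uy.
Qed.

(** Convertible to the successor case of [Pspace], so that what follows applies to
    [Pspace R n.+1]. *)
Definition cantor_maps (T : uniformType) : uniformType :=
  initial_topology
    (id : continuousType cantor_space T -> arrow_uniform_type cantor_space T).

Section cantor_maps.
Variable T : uniformType.

Lemma cantor_maps_complete : uniformly_complete T ->
  uniformly_complete (cantor_maps T).
Proof.
move=> cT; apply: initial_uniformly_complete.
  exact: arrow_uniformly_complete.
move=> F u PF Fu.
have cu := @fct_limit_continuous cantor_space T F u PF Fu.
by exists (mkcts cu : continuousType _ _).
Qed.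

Lemma cantor_maps_hausdorff : hausdorff_space T ->
  hausdorff_space (cantor_maps T).
Proof.
move=> hT; apply: initial_hausdorff; last exact: arrow_hausdorff.
by move=> f g fg; apply/continuousEP => t; rewrite fg.
Qed.

Lemma cantor_maps_countable_uniformity : countable_uniformity T ->
  countable_uniformity (cantor_maps T).
Proof.
by move=> cT; apply: initial_countable_uniformity;
  exact: arrow_countable_uniformity.
Qed.

(** By uniform continuity, a map is approximated by one that depends on the first [n] bits only and
    takes values in [e]; a finite table describes the latter. *)
Lemma cantor_maps_dense_sequence (e : nat -> T) : dense_sequence e ->
  exists g : nat -> cantor_maps T, dense_sequence g.
Proof.
move=> de.
pose h n (s : seq (seq bool * nat)) (x : cantor_space) :=
  e (lookup s (mkseq x n)).
have ch n s : continuous (h n s).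
  by apply: (@locally_constant_continuous bool T n) => x y xy; rewrite /h xy.
exists (fun m => let p := odflt (0%N, [::]) (unpickle m) in
  mkcts (ch p.1 p.2) : continuousType _ _) => f A.
rewrite -nbhs_entourageE => -[C [B [E entE sE] sB] BA].
have [n nE] := cantor_uniform_continuity (@cts_fun _ _ (f : continuousType _ _))
  (entourage_split_ent entE).
(* A sample point of the cylinder of [s], obtained by padding with [false]. *)
pose b (s : seq bool) : cantor_space := nth false s.
have /choice[m mP] : forall s : seq bool, exists m, split_ent E (f (b s), e m).
  move=> s; have [m /xsectionP] :=
    de _ _ (nbhs_entourage (f (b s)) (entourage_split_ent entE)).
  by exists m.
exists (pickle (n, [seq (s, m s) | s <- [seq val t | t <- enum {: n.-tuple
  bool}]])).
rewrite pickleK /=; apply/BA/mem_set/sB/sE => x /=.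
rewrite /mkcts /h lookup_map; last first.
  have sz : size (mkseq x n) == n by rewrite size_mkseq.
  by apply/mapP; exists (Tuple sz) => //; rewrite mem_enum.
apply: (entourage_split (f (b (mkseq x n))) entE _ (mP _)); apply: nE.
by apply/mkseq_eqP => i ik; rewrite /b nth_mkseq.
Qed.

(** [h x] is close to [h y] by continuity of [h], and [h y] to [g y] because [g] is uniformly close
    to [h]. *)
Lemma eval_continuous :
  continuous (fun p : cantor_maps T * cantor_space => (p.1 : continuousType _
    _) p.2).
Proof.
move=> [h x]; apply/cvg_app_entourageP => A entA /=.
have entB := entourage_split_ent entA.
have /cvg_app_entourageP/(_ _ entB) := @cts_fun _ _ (h : continuousType _ _) x.
move=> hx; exists ([set g : cantor_maps T | forall t,
    (split_ent A) ((h : continuousType _ _) t, (g : continuousType _ _) t)],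
  [set y | (split_ent A) ((h : continuousType _ _) x, (h : continuousType _ _)
    y)]).
  split => //=; rewrite -nbhs_entourageE.
  exists [set fg | forall t, split_ent A ((fg.1 : continuousType _ _) t, (fg.2
    : continuousType _ _) t)].
    by exists [set fg | forall t, split_ent A (fg.1 t, fg.2 t)] => //;
      exists (split_ent A).
  by move=> g /xsectionP.
move=> [g y] /= [hg hxy]; exact: entourage_split hxy (hg y).
Qed.

(** Compactness of the Cantor space makes the continuity of [g] in [z] uniform in the second
    variable, as the topology of uniform convergence requires. *)
Lemma curry_continuous (Z : topologicalType) (g : Z * cantor_space -> T) :
  continuous g ->
  exists2 b : Z -> cantor_maps T, continuous b &
    forall z x, (b z : continuousType _ _) x = g (z, x).
Proof.
move=> cg.
have cgz z : continuous (fun x => g (z, x)).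
  move=> x; apply: (@continuous_comp _ _ _ (fun x : cantor_space => (z, x)) g);
    last exact: cg.
  by apply: pair_continuous => y //; exact: cvg_cst.
exists (fun z => mkcts (cgz z) : continuousType _ _) => // z.
apply/cvg_app_entourageP => C [B [E entE sE] sB].
have /compact_near_coveringP cov := cantor_space_compact.
have : \forall z' \near z, [set: cantor_space] `<=` (fun x => E (g (z, x), g
  (z', x))).
  apply: (cov Z (nbhs z) (fun z' x => E (g (z, x), g (z', x)))) => x _.
  have /cvg_app_entourageP/(_ _ (entourage_invI (entourage_split_ent entE))) :=
    cg (z, x).
  move=> [[V W] /= [Vz Wx] VW].
  exists (W, V) => //= -[x' z'] /= [Wx' Vz'].
  apply: (entourage_split (g (z, x))) => //.
    by have [] := VW (z, x') (conj (nbhs_singleton Vz) Wx').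
  by have [] := VW (z', x') (conj Vz' Wx').
apply: filterS => z' zz'; apply/sB/sE => x; exact: zz'.
Qed.

End cantor_maps.

(** * Zero-dimensional Polish spaces *)

Lemma Pspace_polish_uniform (R : realType) n :
  polish_uniform (Pspace R n) /\
  exists e : nat -> Pspace R n, dense_sequence e.
Proof.
elim: n => [|n [[cT hT compT sT] [e de]]].
  split; first exact: tree_functions_polish_uniform.
  apply: power_dense_sequence (unit_itv_dense_sequence (R := R)).
  exact: unit_itv_countable_uniformity.
have [g dg] := @cantor_maps_dense_sequence (Pspace R n) e de.
split; last by exists g.
split.
- exact: (@cantor_maps_countable_uniformity (Pspace R n)).
- exact: (@cantor_maps_hausdorff (Pspace R n)).
- exact: (@cantor_maps_complete (Pspace R n)).
- exact: dense_sequence_separable dg.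
Qed.

Lemma metric_polish_uniform (R : realType) (M : metricType R) :
  uniformly_complete M -> separable M -> polish_uniform M.
Proof.
move=> cM sM; split => //.
- exact: countable_uniformity_metric.
- exact: metric_hausdorff.
Qed.

Lemma separable_homeo (T U : topologicalType) (f : T -> U) (g : U -> T) :
  cancel g f -> continuous f -> separable T -> separable U.
Proof.
move=> gK cf [D cD dD]; exists (f @` D);
  first exact: sub_countable (card_image_le _ _) cD.
move=> O [y Oy] oO.
have [|x [Ox Dx]] := dD (f @^-1` O) _ (open_comp (fun x _ => cf x) oO).
  by exists (g y); rewrite /= gK.
by exists (f x); split => //; exists x.
Qed.

(** [Z] carries only a topology: the product is formed with its metric copy [M] and then transported
    back. *)
Lemma prod_polish (R : realType) (Z : topologicalType) (X : uniformType) :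
  polish R Z -> polish_uniform X -> polish R (Z * X)%type.
Proof.
move=> [sZ [M [f [g [[fK gK cf cg] compM]]]]] pX.
have sM : separable M by exact: separable_homeo gK cf sZ.
have pM : polish_uniform M by exact: metric_polish_uniform.
have [_ [N [f' [g' [[f'K g'K cf' cg'] compN]]]]] :=
  @polish_uniform_polish R _ (prod_polish_uniform pM pX).
split; first by apply: prod_separable => //; have [] := pX.
exists N, (fun p => f' (f p.1, p.2)), (fun q => (g (g' q).1, (g' q).2));
  split => //.
split.
- by move=> [z x] /=; rewrite f'K /= fK.
- by move=> q /=; rewrite gK -surjective_pairing g'K.
- move=> p; apply: (@continuous_comp _ _ _ (fun p => (f p.1, p.2)) f');
  last exact: cf'.
  apply: pair_continuous => q; last exact: cvg_snd.
  by apply: continuous_comp; [exact: cvg_fst|exact: cf].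
- apply: pair_continuous => q.
    apply: (@continuous_comp _ _ _ (fun q => (g' q).1) g); last exact: cg.
    by apply: (@continuous_comp _ _ _ g' fst); [exact: cg'|exact: cvg_fst].
  by apply: (@continuous_comp _ _ _ g' snd); [exact: cg'|exact: cvg_snd].
Qed.

Lemma has_clopen_basisP (T : topologicalType) :
  has_clopen_basis T <->
  forall (x : T) (A : set T), nbhs x A -> exists U, [/\ clopen U, U x & U `<=`
    A].
Proof.
split=> [[_ bT] x A /bT[U [cU Ux] UA]|bT]; first by exists U.
split=> [U []//|x A /bT[U [cU Ux UA]]].
by exists U.
Qed.

Lemma prod_has_clopen_basis (T U : topologicalType) :
  has_clopen_basis T -> has_clopen_basis U -> has_clopen_basis (T * U)%type.
Proof.
move=> /has_clopen_basisP bT /has_clopen_basisP bU.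
apply/has_clopen_basisP => -[x y] A [[B C] /= [/bT[V [cV Vx VB]] /bU[W [cW Wy
  WC]]] BCA].
exists (fst @^-1` V `&` snd @^-1` W); split => //.
  apply: clopenI; apply: preimage_clopen => // p;
    [exact: cvg_fst|exact: cvg_snd].
by move=> [a b] [/VB Ba /WC Cb]; exact: BCA.
Qed.

Lemma cylinder_clopen (K : discreteUniformType) (x : prod_topology (fun _ : nat
  => K)) n :
  clopen [set y : prod_topology (fun _ : nat => K) | mkseq y n = mkseq x n].
Proof.
split.
  rewrite openE => y /= yx; rewrite /interior -yx; exact: cylinder_nbhs.
rewrite -openC openE => y /= yx; have := cylinder_nbhs y n.
by apply: filterS => z /= -> .
Qed.

Lemma power_has_clopen_basis (K : discreteUniformType) :
  has_clopen_basis (prod_topology (fun _ : nat => K)).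
Proof.
apply/has_clopen_basisP => x A /nbhs_cylinder[n nA].
by exists [set y | mkseq y n = mkseq x n]; split => //; exact: cylinder_clopen.
Qed.

(** This replaces membership in an open set by a natural number, namely the index of a clopen piece,
    which can be stored in a point of [baire_space]. *)
Lemma open_bigcup_clopen (R : realType) (Z : topologicalType) (O : set Z) :
  polish R Z -> has_clopen_basis Z -> open O ->
  exists V : nat -> set Z, (forall n, clopen (V n)) /\ O = \bigcup_n V n.
Proof.
move=> [[D cD dD] [M [f [g [[fK gK cf cg] _]]]]] /has_clopen_basisP bZ oO.
have /countable_injP[i iI] := cD.
pose B (d : Z) (k : nat) : set Z := f @^-1` ball (f d) k.+1%:R^-1.
(* Choose a clopen set between each basic ball and O whenever there is one. *)
pose good (n : nat) (V : set Z) := clopen V /\ V `<=` O /\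
  exists d k, [/\ D d, n = pickle (i d, k) & B d k `<=` V].
have /choice[V VP] : forall n, exists V, good n V \/ (V = set0 /\ ~ exists W,
  good n W).
  move=> n; have [[W gW]|nW] := pselect (exists W, good n W).
    by exists W; left.
  by exists set0; right.
exists V; split.
  by move=> n; have [[]//|[-> _]] := VP n; exact: clopen0.
apply/seteqP; split => [z Oz|z [n _]]; last first.
  by have [[_ [VO _]]|[->//]] := VP n => /VO.
have [W [cW Wz WO]] : exists U, [/\ clopen U, U z & U `<=` O].
  by apply: bZ; exact: open_nbhs_nbhs.
have : nbhs (f z) (g @^-1` W).
  by apply: cg; rewrite fK; apply: open_nbhs_nbhs; split => //; exact: cW.1.
rewrite -(@filter_from_ballE R M) => -[e /= e0 eW].
(* The factor 2 pays for the triangle inequality through the centre [d]. *)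
have [k ke] : exists k, 2 * k.+1%:R^-1 <= e.
  exists (Num.truncn (2 / e)).
  rewrite -ler_pdivlMl// mulrC -[leRHS]invrK lef_pV2 ?posrE ?invr_gt0
    ?mulr_gt0//.
  by rewrite invfM invrK mulrC ltW// truncnS_gt.
have k0 : 0 < k.+1%:R^-1 :> R by rewrite invr_gt0.
have [|d [dz Dd]] := dD (f @^-1` (ball (f z) k.+1%:R^-1)°) _ (open_comp (fun x
  _ => cf x) (@open_interior _ _)).
  by exists z => /=; exact: (nbhsx_ballx _ _ k0).
have zd := interior_subset dz.
pose n := pickle (i d, k).
have gn : good n W.
  split => //; split => //; exists d, k; split => // y Bdy.
  rewrite -(fK y); apply: (eW (f y)); apply: (le_ball ke).
  by rewrite mulr_natl mulr2n; exact: ball_triangle zd Bdy.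
(* The set chosen at [n] may differ from [W], and it comes with its own [d'] and [k']; injectivity
   of the code shows that its ball is the same. *)
have [[_ [_ [d' [k' [Dd' nE BV]]]]]|[_ []]] := VP n; last by exists W.
exists n => //; apply: BV.
have /= [/iI dd' <-] : (i d, k) = (i d', k') by exact: (pcan_inj pickleK) nE.
rewrite -dd' ?inE//; exact: ball_sym.
Qed.

(** * Projective classes *)

(** [phi] is locally constant, so near a point a single member of the family matters. *)
Lemma discrete_family_continuous (Y T : topologicalType)
    (D : discreteTopologicalType) (phi : Y -> D) (h : D -> Y -> T) :
  continuous phi -> (forall d, continuous (h d)) ->
  continuous (fun y => h (phi y) y).
Proof.
move=> cphi ch y A hA.
have phiy : nbhs y [set z | phi z = phi y] := cphi y _ (discrete_set1 (phi y)).
have hy : nbhs y (h (phi y) @^-1` A) := ch (phi y) y A hA.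
by apply: filterS2 phiy hy => z /= -> .
Qed.

Lemma discrete_comp_continuous (Y T : topologicalType)
    (D : discreteTopologicalType) (phi : Y -> D) (h : D -> T) :
  continuous phi -> continuous (fun y => h (phi y)).
Proof.
move=> cphi; apply: (@discrete_family_continuous _ _ _ phi (fun d _ => h d)) =>
  // d y.
exact: cvg_cst.
Qed.

Lemma closed_bool (Y : topologicalType) (c : Y -> bool) : continuous c ->
  closed [set y | c y].
Proof.
move=> cc; have -> : [set y | c y] = c @^-1` [set true] by [].
apply: preimage_closed => //; exact: discrete_closed.
Qed.

Lemma clopen_asbool (Y : topologicalType) (V : set Y) : clopen V ->
  continuous (fun y => `[< V y >]).
Proof.
move=> [oV cV] y A /nbhs_singleton; case: asboolP => [Vy|nVy] Ay.
  have : nbhs y V by exact: open_nbhs_nbhs.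
  by apply: filterS => z /asboolT /= ->.
have : nbhs y (~` V) by apply: open_nbhs_nbhs; split => //; exact: closed_openC.
by apply: filterS => z /asboolF /= ->.
Qed.

Section sequences.
Context {Y : topologicalType} {K : discreteUniformType}.
Let T : uniformType := prod_topology (fun _ : nat => K).

Lemma coordinate_continuous (x : Y -> T) n : continuous x ->
  continuous (fun y => x y n).
Proof.
move=> cx y; apply: (@continuous_comp _ _ _ x (@proj _ (fun _ : nat => K) n)).
  exact: cx.
exact: (@proj_continuous _ (fun _ : nat => K)).
Qed.

Lemma sequence_continuous (x : Y -> T) :
  (forall n, continuous (fun y => x y n)) -> continuous x.
Proof.
move=> cx y; apply: prod_topology_cvg => n; exact: cx.
Qed.

End sequences.

Definition tail (a : baire_space) : baire_space := fun n => a n.+1.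
Definition evens (a : baire_space) : baire_space := fun n => a n.*2.
Definition odds (a : baire_space) : baire_space := fun n => a n.*2.+1.
Definition stream_cons k (a : baire_space) : baire_space :=
  fun n => if n is m.+1 then a m else k.
Definition interleave (a b : baire_space) : baire_space :=
  fun n => if odd n then b n./2 else a n./2.

Lemma evens_interleave a b : evens (interleave a b) = a.
Proof. by apply/funext => n; rewrite /evens /interleave odd_double doubleK. Qed.

Lemma odds_interleave a b : odds (interleave a b) = b.
Proof.
by apply/funext => n; rewrite /odds /interleave /= odd_double /= uphalf_double.
Qed.

Lemma reindex_continuous (phi : nat -> nat) :
  continuous ((fun a n => a (phi n)) : baire_space -> baire_space).
Proof.
apply: (@sequence_continuous baire_space nat) => n.
by apply: (@coordinate_continuous baire_space nat id) => a; exact: cvg_id.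
Qed.

Lemma tail_continuous : continuous tail. Proof. exact: reindex_continuous. Qed.
Lemma evens_continuous : continuous evens. Proof. exact: reindex_continuous.
  Qed.
Lemma odds_continuous : continuous odds. Proof. exact: reindex_continuous. Qed.

Lemma Pi1_preimage n (X Y : topologicalType) (f : X -> Y) (A : set Y) :
  continuous f -> Pi1 n A -> Pi1 n (f @^-1` A).
Proof.
elim: n X Y f A => [|n IH] X Y f A cf; first by apply: preimage_closed.
move=> [B nB AB]; exists ((fun p => (f p.1, p.2)) @^-1` B).
  apply: IH nB; apply: pair_continuous => p; last exact: cvg_snd.
  by apply: continuous_comp; [exact: cvg_fst|exact: cf].
rewrite preimage_setC AB; apply/seteqP;
  split => [x [[y a] Bya /= yx]|x [[y a] By <-]].
  by exists (x, a) => //=; rewrite -yx.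
by exists (f y, a).
Qed.

Definition zero_dimensional_polish R (X : topologicalType) :=
  polish R X /\ has_clopen_basis X.

Section zero_dimensional_polish.
Variable R : realType.
Local Notation zdp := (zero_dimensional_polish R).

Lemma zdp_baire : zdp baire_space.
Proof.
split; last exact: (@power_has_clopen_basis nat).
exact: polish_uniform_polish baire_polish_uniform.
Qed.

Lemma zdp_cantor : zdp cantor_space.
Proof.
split; last exact: (@power_has_clopen_basis bool).
exact: polish_uniform_polish cantor_polish_uniform.
Qed.

Lemma zdp_prod_baire X : zdp X -> zdp (X * baire_space)%type.
Proof.
move=> [pX bX]; split.
  exact: prod_polish pX baire_polish_uniform.
exact: prod_has_clopen_basis bX zdp_baire.2.
Qed.

Lemma zdp_prod_cantor X : zdp X -> zdp (X * cantor_space)%type.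
Proof.
move=> [pX bX]; split.
  exact: prod_polish pX cantor_polish_uniform.
exact: prod_has_clopen_basis bX zdp_cantor.2.
Qed.

(** Complementation exchanges intersection and union, so both claims go through one induction. The
    open complement of [K] is split into clopen pieces to keep the condition on the witness
    simple. *)
Lemma Pi1_closed n (X : topologicalType) (A K : set X) : zdp X -> Pi1 n A ->
  closed K ->
  Pi1 n (A `&` K) /\ Pi1 n (A `|` K).
Proof.
elim: n X A K => [|n IH] X A K zX nA cK.
  by split; [exact: closedI|exact: closedU].
have [C nC AC] := nA.
have [V [cV KV]] := open_bigcup_clopen zX.1 zX.2 (closed_openC cK).
have zXB := zdp_prod_baire zX.
have ctail : continuous (fun p : X * baire_space => (p.1, tail p.2)).
  apply: pair_continuous => p; first exact: cvg_fst.
  by apply: continuous_comp; [exact: cvg_snd|exact: tail_continuous].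
have nC' := Pi1_preimage ctail nC.
have c0 : continuous (fun p : X * baire_space => p.2 0%N).
  by apply: coordinate_continuous => p; exact: cvg_snd.
have cVi f : continuous (fun p : X * baire_space => `[< V (f (p.2 0%N)) p.1 >]).
  apply: (@discrete_family_continuous _ _ nat (fun p : X * baire_space => p.2
    0%N)
    (fun n (p : X * baire_space) => `[< V (f n) p.1 >])) => // k p.
  apply: (@continuous_comp _ _ _ fst (fun x => `[< V (f k) x >])).
    exact: cvg_fst.
  exact: clopen_asbool.
split.
  (* The head of the witness is a tag: 0 announces that the tail witnesses membership in the
     projection of [C], and [i.+1] announces a point of [V i]. *)
  exists (((fun p : X * baire_space => (p.1, tail p.2)) @^-1` C `&`
      [set p | p.2 0%N == 0%N]) `|`
      [set p | (p.2 0%N != 0%N) && `[< V (p.2 0%N).-1 p.1 >]]).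
    apply: (IH _ _ _ zXB _ _).2.
      apply: (IH _ _ _ zXB nC' _).1; apply: closed_bool.
      exact: (@discrete_comp_continuous _ bool nat _ (fun n => n == 0%N) c0).
    apply: closed_bool.
    apply: (@discrete_family_continuous _ _ nat (fun p : X * baire_space => p.2
      0%N)
      (fun n (p : X * baire_space) => (n != 0%N) && `[< V n.-1 p.1 >])) => // k
        p.
    apply: (@continuous_comp _ _ _ fst (fun x => (k != 0%N) && `[< V k.-1 x
      >])).
      exact: cvg_fst.
    apply: (@discrete_comp_continuous _ bool bool _ (andb (k != 0%N))).
    exact: clopen_asbool.
  rewrite setCI AC KV; apply/seteqP; split => [x [[[y a] Cya /= <-]|[i _ Vx]]|].
  - by exists (y, stream_cons 0 a) => //; left.
  - exists (x, stream_cons i.+1 (fun=> 0%N)) => //; right => /=; exact/asboolP.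
  move=> _ [[y a] [[Cya _]|/andP[_ /asboolP Vy]] <-] /=.
    by left; exists (y, tail a).
  by right; exists (a 0%N).-1.
(* Both conditions must hold here, so the head is the index of the clopen piece itself. *)
exists ((fun p : X * baire_space => (p.1, tail p.2)) @^-1` C `&`
    [set p | `[< V (p.2 0%N) p.1 >]]).
  by apply: (IH _ _ _ zXB nC' _).1; apply: closed_bool; exact: (cVi id).
rewrite setCU AC KV; apply/seteqP; split.
  move=> _ [[[y a] Cya <-] [i _ Vx]]; exists (y, stream_cons i a) => //.
  by split => //=; exact/asboolP.
move=> _ [[y a] [Cya /asboolP Vy] <-] /=; split; first by exists (y, tail a).
by exists (a 0%N).
Qed.

End zero_dimensional_polish.

(** * Coding sequences of natural numbers by binary sequences *)

(* A real g may code at most one sequence a: a i is the least j such that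
   g (pickle (i, j)).  Not coding any sequence is then an F_sigma condition,
   see [not_codesP]. *)
Definition codes (g : cantor_space) (a : baire_space) :=
  forall i j, (j <= a i)%N -> g (pickle (i, j)) = (j == a i).

Lemma codes_inj g a b : codes g a -> codes g b -> a = b.
Proof.
have le a' b' i : codes g a' -> codes g b' -> (b' i <= a' i)%N.
  move=> ga gb; rewrite leqNgt; apply/negP => ab.
  have := ga i (a' i) (leqnn _); rewrite eqxx (gb i (a' i) (ltnW ab)).
  by rewrite ltn_eqF.
by move=> ga gb; apply/funext => i; apply/eqP; rewrite eqn_leq !le.
Qed.

Lemma codes_ex a : exists g, codes g a.
Proof.
exists (fun n => if (unpickle n : option (nat * nat)) is Some (i, j)
  then j == a i else false) => i j _.
by rewrite pickleK.
Qed.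

Lemma not_codesP g :
  (~ exists a, codes g a) <-> exists i : nat, forall j : nat, ~~ g (pickle (i,
    j)).
Proof.
split=> [gN|[i gi] [a ga]]; last first.
  by have := gi (a i); rewrite (ga i (a i)) ?eqxx.
apply: contrapT => gi; apply: gN.
have ex (i : nat) : exists j : nat, g (pickle (i, j)).
  apply: contrapT => nj; apply: gi; exists i => j; apply/negP => gij.
  by apply: nj; exists j.
exists (fun i => ex_minn (ex i)) => i j; case: ex_minnP => m gm mmin jm.
have [->//|jNm] := eqVneq; apply/negbTE/negP => /mmin.
by rewrite leqNgt ltn_neqAle jNm jm.
Qed.

Lemma codes_closed (Y : topologicalType) (g : Y -> cantor_space)
    (a : Y -> baire_space) : continuous g -> continuous a ->
  closed [set y | codes (g y) (a y)].
Proof.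
move=> cg ca.
have -> : [set y | codes (g y) (a y)] = \bigcap_(ij in [set: nat * nat])
    [set y | (ij.2 <= a y ij.1)%N ==> (g y (pickle ij) == (ij.2 == a y ij.1))].
  apply/seteqP; split => [y gay [i j] _ /=|y gay i j ij].
    by apply/implyP => /gay/= ->.
  by have /implyP/(_ ij)/eqP := gay (i, j) I.
apply: closed_bigI => -[i j] _ /=; apply: closed_bool.
apply: (@discrete_family_continuous _ _ nat (fun y => a y i)
  (fun k y => (j <= k)%N ==> (g y (pickle (i, j)) == (j == k)))).
  exact: (@coordinate_continuous Y nat).
move=> k; apply: (@discrete_comp_continuous _ bool bool _
  (fun b => (j <= k)%N ==> (b == (j == k)))).
exact: (@coordinate_continuous Y bool).
Qed.

Lemma comp_continuous (X Y T : topologicalType) (f : X -> Y) (g : Y -> T) :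
  continuous f -> continuous g -> continuous (fun x => g (f x)).
Proof. by move=> cf cg x; apply: continuous_comp; [exact: cf|exact: cg]. Qed.

Lemma continuous_fst_comp (X Y T : topologicalType) (f : X -> T) :
  continuous f -> continuous (fun p : X * Y => f p.1).
Proof. by move=> cf p; apply: continuous_comp; [exact: cvg_fst|exact: cf]. Qed.

Lemma continuous_snd_comp (X Y T : topologicalType) (f : Y -> T) :
  continuous f -> continuous (fun p : X * Y => f p.2).
Proof. by move=> cf p; apply: continuous_comp; [exact: cvg_snd|exact: cf]. Qed.

(** Since a code determines its sequence, the complement is again existential: [g] codes nothing, or
    it codes some [a] with [(z, a)] outside [B]. Hence the quantifier over [a] does not raise the
    class. *)
Lemma Pi1_decode (R : realType) n (Z : topologicalType)
    (B : set (Z * baire_space)) : zero_dimensional_polish R Z -> Pi1 n.+1 B ->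
  Pi1 n.+1 [set p : Z * cantor_space | exists2 a, codes p.2 a & B (p.1, a)].
Proof.
move=> zZ [C nC BC].
have zW := zdp_prod_baire (zdp_prod_cantor zZ).
pose W : topologicalType := ((Z * cantor_space) * baire_space)%type.
have ctail : continuous (fun p : W => tail p.2).
  exact: continuous_snd_comp tail_continuous.
have cev : continuous (fun p : W => evens (tail p.2)).
  exact: comp_continuous ctail evens_continuous.
have cod : continuous (fun p : W => odds (tail p.2)).
  exact: comp_continuous ctail odds_continuous.
have czc : continuous (fun p : W => p.1.2).
  by apply: continuous_fst_comp => p; exact: cvg_snd.
have cz : continuous (fun p : W => p.1.1).
  by apply: continuous_fst_comp => p; exact: cvg_fst.
have c0 : continuous (fun p : W => p.2 0%N).
  by apply: coordinate_continuous => p; exact: cvg_snd.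
pose phi (p : W) := ((p.1.1, evens (tail p.2)), odds (tail p.2)).
have cphi : continuous phi.
  by apply: pair_continuous => //; exact: pair_continuous.
(* Under head 0 the tail interleaves the coded sequence with a witness that it falls outside [B];
   head [i.+1] announces that row [i] of [g] is identically false. *)
exists ((phi @^-1` C `&` ([set p : W | p.2 0%N == 0%N] `&`
    [set p : W | codes p.1.2 (evens (tail p.2))])) `|`
  \bigcap_(j in [set: nat]) [set p : W | (p.2 0%N != 0%N) &&
    ~~ p.1.2 (pickle ((p.2 0%N).-1, j))]).
  apply: (Pi1_closed zW _ _).2.
    apply: (Pi1_closed zW (Pi1_preimage cphi nC) _).1; apply: closedI.
      apply: closed_bool.
      exact: (@discrete_comp_continuous _ bool nat _ (fun n => n == 0%N)).
    exact: codes_closed.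
  apply: closed_bigI => j _; apply: closed_bool.
  apply: (@discrete_family_continuous W bool nat (fun p => p.2 0%N)
    (fun k p => (k != 0%N) && ~~ p.1.2 (pickle (k.-1, j)))) => // k.
  apply: (@discrete_comp_continuous W bool bool (fun p => p.1.2 (pickle (k.-1,
    j)))
    (fun b => (k != 0%N) && ~~ b)).
  exact: (@coordinate_continuous W bool (fun p => p.1.2)).
apply/seteqP; split; last first.
  move=> _ [[[z g] d] /= H <-] [a ga Bza].
  case: H => /= [[Cd [_ gd]]|gN].
    have : (~` B) (z, evens (tail d)).
      by rewrite BC; exists (z, evens (tail d), odds (tail d)).
    by rewrite (codes_inj gd ga).
  have /not_codesP : exists i : nat, forall j : nat, ~~ g (pickle (i, j)).
    by exists (d 0%N).-1 => j; have /andP[] := gN j I.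
  by apply; exists a.
move=> [z g] /= nB.
have [[a ga]|/not_codesP[i gi]] := pselect (exists a, codes g a).
  have : (~` B) (z, a) by move=> Bza; apply: nB; exists a.
  rewrite BC => -[[[z' a'] b] Cb [zE aE]].
  exists ((z, g), stream_cons 0 (interleave a b)) => //; left.
  rewrite /phi /= -[tail _]/(interleave a b) evens_interleave odds_interleave.
  by split => //=; rewrite -zE -aE.
by exists ((z, g), stream_cons i.+1 (fun=> 0%N)) => //; right => j _ /=.
Qed.

(** A continuous surjection, through which quantifiers over [cantor_space] become quantifiers over
    [baire_space]. *)
Definition bits (a : baire_space) : cantor_space := fun n => a n != 0%N.

Lemma bits_continuous : continuous bits.
Proof.
apply: (@sequence_continuous baire_space bool) => n.
apply: (@discrete_comp_continuous _ bool nat _ (fun k => k != 0%N)).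
by apply: (@coordinate_continuous baire_space nat id) => a; exact: cvg_id.
Qed.

Lemma bits_surj (g : cantor_space) : exists a, bits a = g.
Proof. by exists (fun n => g n : nat); apply/funext => n; rewrite /bits;
  case: (g n). Qed.

Lemma Pi1_cantor_coprojection n (T X : topologicalType) (f : T * cantor_space
  -> X)
    (C : set X) : continuous f -> Pi1 n C ->
  Pi1 n.+1 [set t | forall b, ~ C (f (t, b))].
Proof.
move=> cf nC; exists ((fun p => f (p.1, bits p.2)) @^-1` C).
  apply: Pi1_preimage nC => p.
  apply: (@continuous_comp _ _ _ (fun p => (p.1, bits p.2)) f); last exact: cf.
  apply: pair_continuous => q; first exact: cvg_fst.
  by apply: continuous_comp; [exact: cvg_snd|exact: bits_continuous].
apply/seteqP; split => [t /existsNP[b /contrapT Cb]|_ [[t a] Ca <-]] /=.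
  by have [a ab] := bits_surj b; exists (t, a) => //=; rewrite ab.
by move=> /(_ (bits a)).
Qed.

(** * Everywhere converging martingales *)

Lemma inv_succ_le (R : realType) (e : R) : 0 < e ->
  exists k : nat, k.+1%:R^-1 <= e.
Proof.
move=> e0; exists (Num.truncn e^-1).
by rewrite -[leRHS]invrK lef_pV2 ?posrE ?invr_gt0// ltW// truncnS_gt.
Qed.

(** The tolerances are indexed by natural numbers so that a failure of convergence can be recorded
    in a point of [baire_space]. *)
Lemma cvgn_cauchyP (R : realType) (u : nat -> R) :
  cvgn u <-> forall k : nat, exists N : nat, forall i j,
    (N <= i)%N -> (N <= j)%N -> `|u i - u j| < k.+1%:R^-1.
Proof.
split=> [/cvg_ex[l /cvgrPdist_lt ul] k|uP].
  have e0 : 0 < k.+1%:R^-1 / 2 :> R by rewrite divr_gt0// invr_gt0.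
  have [N _ NP] := ul _ e0; exists N => i j Ni Nj.
  rewrite (splitr k.+1%:R^-1) -[u i](subrK l) -addrA.
  apply: le_lt_trans (ler_normD _ _) (ltrD _ _); last exact: NP.
  by rewrite distrC; exact: NP.
apply: (@cauchy_cvg R) => E; rewrite -entourage_ballE => -[e /= e0 eE].
have [k ke] := inv_succ_le e0; have [N NP] := uP k.
exists (u @` [set i | (N <= i)%N], u @` [set i | (N <= i)%N]).
  by split; exists N => // i Ni; exists i.
move=> [_ _] [/= [i Ni <-] [j Nj <-]]; apply: eE => /=.
exact: lt_le_trans (NP i j Ni Nj) ke.
Qed.

Section base.
Variable R : realType.
Local Notation T := (tree_functions R).

Lemma subr_continuous (Y : topologicalType) (g h : Y -> R) :
  continuous g -> continuous h -> continuous (fun y => g y - h y).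
Proof. by move=> cg ch y; exact: (@cvgB R R^o _ _ _ _ _ _ _ (cg y) (ch y)). Qed.

Lemma addr_continuous (Y : topologicalType) (g h : Y -> R) :
  continuous g -> continuous h -> continuous (fun y => g y + h y).
Proof. by move=> cg ch y; exact: (@cvgD R R^o _ _ _ _ _ _ _ (cg y) (ch y)). Qed.

Lemma mulr_const_continuous (Y : topologicalType) (g : Y -> R) (c : R) :
  continuous g -> continuous (fun y => g y * c).
Proof. by move=> cg y; apply: cvgMr_tmp; exact: cg. Qed.

Lemma normr_continuous (Y : topologicalType) (g : Y -> R) :
  continuous g -> continuous (fun y => `|g y|).
Proof. by move=> cg y; exact: (@cvg_norm R R^o _ _ _ _ _ (cg y)). Qed.

Lemma val_continuous : continuous (fun x : unit_itv R => \val x : R).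
Proof. exact: initial_continuous. Qed.

Lemma tree_value_continuous (s : seq bool) : continuous (fun f : T => \val (f
  s) : R).
Proof.
apply: comp_continuous val_continuous.
exact: (@proj_continuous _ (fun _ : seq bool => unit_itv R) s).
Qed.

Definition defect (f : T) (s : seq bool) : R :=
  `|\val (f s) - (\val (f (rcons s false)) + \val (f (rcons s true))) / 2|.

Lemma defect_continuous s : continuous (fun f : T => defect f s).
Proof.
apply: normr_continuous; apply: subr_continuous.
  exact: tree_value_continuous.
apply: mulr_const_continuous.
exact: (addr_continuous (@tree_value_continuous (rcons s false))
    (@tree_value_continuous (rcons s true))).
Qed.

Definition oscillation (f : T) (b : cantor_space) (i j : nat) : R :=
  `|\val (f (mkseq b i)) - \val (f (mkseq b j))|.

Lemma branch_value_continuous (Y : topologicalType) (f : Y -> T)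
    (b : Y -> cantor_space) (i : Y -> nat) :
  continuous f -> continuous b -> continuous i ->
  continuous (fun y => \val (f y (mkseq (b y) (i y))) : R).
Proof.
move=> cf cb ci.
apply: (@discrete_family_continuous Y R nat i
  (fun n y => \val (f y (mkseq (b y) n)))) => // n.
have cbn : continuous (fun y => mkseq (b y) n : discrete_topology (seq bool)).
  apply: (@comp_continuous Y cantor_space (discrete_topology (seq bool)) b
    (fun x => mkseq x n) cb).
  exact: (@locally_constant_continuous bool _ n).
apply: (@discrete_family_continuous Y R (discrete_topology (seq bool)) _
  (fun s y => \val (f y s)) cbn) => s.
exact: comp_continuous cf (@tree_value_continuous s).
Qed.

Lemma closed_le_fun (Y : topologicalType) (g h : Y -> R) :
  continuous g -> continuous h -> closed [set y | g y <= h y].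
Proof.
move=> cg ch.
have -> : [set y | g y <= h y] = (fun y => h y - g y) @^-1` [set x | 0 <= x].
  by apply/seteqP; split => y /=; rewrite subr_ge0.
apply: preimage_closed; last exact: closed_ge.
move=> y _; exact: (subr_continuous ch cg).
Qed.

(** Being outside the set has a witness satisfying closed conditions: a word where the mean fails by
    a definite amount, or a branch along which an oscillation of definite size recurs beyond every
    position. *)
Lemma Cset0_Pi1 : Pi1 1 (@Cset R 0).
Proof.
pose W : topologicalType := (T * baire_space)%type.
(* The sequence [p.2] is read in two ways. Under head 0, term 1 codes a word and term 2 bounds the
   defect there; otherwise the tail interleaves a branch with two sequences of positions. *)
pose s (p : W) : discrete_topology (seq bool) :=
  odflt [::] (unpickle (p.2 1%N)).
pose b (p : W) := bits (evens (tail p.2)).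
pose i (n : nat) (p : W) := evens (odds (tail p.2)) n.
pose j (n : nat) (p : W) := odds (odds (tail p.2)) n.
pose e (n : nat) (p : W) : R := (p.2 n).+1%:R^-1.
have cc n : continuous (fun p : W => p.2 n).
  by apply: (@coordinate_continuous W nat snd) => p; exact: cvg_snd.
have ce n : continuous (e n).
  exact: (@discrete_comp_continuous _ R nat _ (fun k => k.+1%:R^-1)).
have cs : continuous s.
  exact: (@discrete_comp_continuous _ _ nat _ (fun k => odflt [::] (unpickle k)
    : discrete_topology (seq bool))).
have ct : continuous (fun p : W => tail p.2) by exact: continuous_snd_comp
  tail_continuous.
have cb : continuous b.
  exact: comp_continuous (comp_continuous ct evens_continuous) bits_continuous.
have ci n : continuous (i n).
  exact: (@coordinate_continuous W nat _ n (comp_continuous (comp_continuous ct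
    odds_continuous) evens_continuous)).
have cj n : continuous (j n).
  exact: (@coordinate_continuous W nat _ n (comp_continuous (comp_continuous ct
    odds_continuous) odds_continuous)).
have cf : continuous (fst : W -> T) by move=> p; exact: cvg_fst.
(* A nonzero first term of the witness announces an oscillation of size at
   least its inverse along the branch b, at the positions i n and j n >= n. *)
exists ([set p : W | p.2 0%N == 0%N] `&` [set p | e 2%N p <= defect p.1 (s p)]
  `|`
  [set p : W | p.2 0%N != 0%N] `&` \bigcap_(n in [set: nat])
    ([set p : W | (n <= i n p)%N && (n <= j n p)%N] `&`
     [set p : W | e 0%N p <= oscillation p.1 (b p) (i n p) (j n p)])).
  apply: closedU; apply: closedI.
  - apply: closed_bool; exact: (@discrete_comp_continuous _ bool nat _ (fun n
    => n == 0%N)).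
  - apply: closed_le_fun => //.
    apply: (@discrete_family_continuous W R (discrete_topology (seq bool)) s
      (fun t p => defect p.1 t) cs) => t.
    exact: comp_continuous cf (@defect_continuous t).
  - apply: closed_bool; exact: (@discrete_comp_continuous _ bool nat _ (fun n
    => n != 0%N)).
  apply: closed_bigI => n _; apply: closedI.
    apply: closed_bool.
    apply: (@discrete_family_continuous W bool nat (i n)
      (fun k p => (n <= k)%N && (n <= j n p)%N)) => // k.
    exact: (@discrete_comp_continuous W bool nat (j n) (fun l => (n <= k)%N &&
      (n <= l)%N)).
  apply: closed_le_fun => //; apply: normr_continuous.
  by apply: subr_continuous; exact: branch_value_continuous.
apply/seteqP; split; last first.
  move=> _ [[f d] [[/= d0 fs]|[/= d0 fb]] <-] [fm fc].
    move: fs; rewrite /defect -fm subrr normr0 leNgt => /negP; apply.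
    by rewrite invr_gt0.
  have /cvgn_cauchyP/(_ (d 0%N))[N NP] := fc (b (f, d)).
  have [/andP[Ni Nj] /= ] := fb N I.
  by rewrite /oscillation leNgt => /negP; apply; exact: NP.
move=> f /not_andP[|] nf.
  have /existsNP[t ft] := nf.
  have [k ke] : exists k : nat, k.+1%:R^-1 <= defect f t.
    by apply: inv_succ_le; rewrite normr_gt0 subr_eq0; exact/eqP.
  exists (f, stream_cons 0 (stream_cons (pickle t) (stream_cons k (fun=>
    0%N)))) => //.
  by left; split => //; rewrite /= /e /s -[X in unpickle X]/(pickle t) pickleK.
have /existsNP[x fx] := nf.
have /existsNP[k kP] : ~ forall k : nat, exists N : nat, forall i j,
    (N <= i)%N -> (N <= j)%N ->
    `|\val (f (mkseq x i)) - \val (f (mkseq x j))| < k.+1%:R^-1 :> R.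
  by move=> H; apply: fx; apply/cvgn_cauchyP.
have /choice[h hP] : forall n, exists q : nat * nat, [/\ (n <= q.1)%N, (n <=
  q.2)%N &
    k.+1%:R^-1 <= oscillation f x q.1 q.2].
  move=> n; apply: contrapT => nq; apply: kP; exists n => i' j' ni nj.
  by rewrite ltNge; apply/negP => ij; apply: nq; exists (i', j').
have [a ax] := bits_surj x.
pose d := interleave a (interleave (fun n => (h n).1) (fun n => (h n).2)).
have dE : tail (stream_cons k.+1 d) = d by [].
exists (f, stream_cons k.+1 d) => //; right; split => // n _.
rewrite /setI /mkset /b /i /j /e /= dE /d odds_interleave evens_interleave.
rewrite odds_interleave evens_interleave ax; have [-> -> H] := hP n;
  split => //.
(* With head [k.+1], which is nonzero as required, the bound becomes 1/(k+2), smaller than the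
   available 1/(k+1). *)
by apply: le_trans H; rewrite lef_pV2 ?posrE// ler_nat.
Qed.

End base.

(** * The martingale of a tree *)

(* After reading a word, [Wait t k] is the state "node t, then k zeros" and
   [Fork t k] is "node t, then k zeros and a one" when the child [rcons t k] of
   t belongs to the tree; the next bit leads to this child or to its sibling
   [Dead t true].  [Dead t false] means that this child is not in the tree. *)
Inductive state :=
| Wait of seq nat & nat
| Fork of seq nat & nat
| Dead of seq nat & bool.

Definition trace (st : state) : seq nat :=
  match st with Wait t _ | Fork t _ | Dead t _ => t end.

Section automaton.
Variable T : seq nat -> bool.

Definition step (st : state) (b : bool) : state :=
  match st with
  | Wait t k => if b then if T (rcons t k) then Fork t k else Dead t false
                else Wait t k.+1
  | Fork t k => if b then Wait (rcons t k) 0 else Dead t true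
  | Dead t c => Dead t c
  end.

Definition run (s : seq bool) : state := foldl step (Wait [::] 0) s.

Lemma run_mkseqS (b : nat -> bool) n :
  run (mkseq b n.+1) = step (run (mkseq b n)) (b n).
Proof. by rewrite mkseqS /run foldl_rcons. Qed.

(** Invariant of the runs; a [Fork] has to remember that its child is in the tree, because the next
    bit may append it to the trace. *)
Definition sound (st : state) :=
  (forall i, (i < size (trace st))%N -> T (take i.+1 (trace st))) /\
  if st is Fork t k then T (rcons t k) else true.

Lemma step_sound st b : sound st -> sound (step st b).
Proof.
case: st b => [t k|t k|t c] b [/= st Tk]; last by split.
  by case: b => //=; case: ifP => // Tk'; split => //=; rewrite Tk'.
case: b => //=; split=> //= i; rewrite size_rcons ltnS leq_eqVlt.
case/predU1P => [->|it]; first by rewrite -(size_rcons t k) take_size.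
by rewrite -cats1 takel_cat//; exact: st.
Qed.

Lemma run_sound s : sound (run s).
Proof.
elim/last_ind: s => [|s b IH]; first by split.
by rewrite /run foldl_rcons; exact: step_sound.
Qed.

Lemma step_prefix st b : prefix (trace st) (trace (step st b)).
Proof.
by case: st b => [t k|t k|t c] [] //=; rewrite ?prefix_refl ?prefix_rcons//;
  case: ifP; rewrite /= prefix_refl.
Qed.

Lemma run_prefix (b : nat -> bool) m n : (m <= n)%N ->
  prefix (trace (run (mkseq b m))) (trace (run (mkseq b n))).
Proof.
elim: n => [|n IH]; first by rewrite leqn0 => /eqP ->; exact: prefix_refl.
rewrite leq_eqVlt => /predU1P[->|mn]; first exact: prefix_refl.
by rewrite run_mkseqS (prefix_trans (IH mn))// step_prefix.
Qed.

(** The traces along [b] extend one another, and when their lengths are unbounded their union is an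
    infinite sequence. *)
Lemma run_branch (b : nat -> bool) :
  (forall j, exists n, (j <= size (trace (run (mkseq b n))))%N) ->
  exists a : nat -> nat, forall j, T (mkseq a j.+1).
Proof.
move=> big; pose t n := trace (run (mkseq b n)).
have /choice[h hP] : forall j, exists n, (j < size (t n))%N.
  by move=> j; exact: big j.+1.
(* Entry [i] is read at a stage [h i] whose trace is long enough; [run_prefix] makes the choice of
   stage irrelevant. *)
exists (fun i => nth 0%N (t (h i)) i) => j.
suff -> : mkseq (fun i => nth 0%N (t (h i)) i) j.+1 = take j.+1 (t (h j)).
  by apply: (run_sound _).1; exact: hP.
apply: (@eq_from_nth _ 0%N); rewrite size_mkseq.
  by rewrite size_takel//; exact: hP.
move=> i ij; rewrite nth_mkseq// nth_take//.
have ji : (i < size (t (h j)))%N by exact: leq_ltn_trans (hP j).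
have [hij|/ltnW hji] := leqP (h i) (h j).
  have /prefixP[s ->] : prefix (t (h i)) (t (h j)) by exact: run_prefix.
  by rewrite nth_cat hP.
have /prefixP[s ->] : prefix (t (h j)) (t (h i)) by exact: run_prefix.
by rewrite nth_cat ji.
Qed.

(* The next bit to be read in order to go down the branch a. *)
Definition follow (a : nat -> nat) (st : state) : bool :=
  if st is Wait t k then k == a (size t) else true.

Fixpoint orbit (a : nat -> nat) n : state :=
  if n is m.+1 then step (orbit a m) (follow a (orbit a m)) else Wait [::] 0.

Lemma run_orbit a n : run (mkseq (fun i => follow a (orbit a i)) n) = orbit a n.
Proof. by elim: n => // n IH; rewrite run_mkseqS IH. Qed.

Lemma orbit_branch (a : nat -> nat) : (forall j, T (mkseq a j.+1)) ->
  forall j, exists2 n, (j <= n)%N & orbit a n = Wait (mkseq a j) 0.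
Proof.
move=> Ta; elim => [|j [n jn nE]]; first by exists 0%N.
have wait i : (i <= a j)%N -> orbit a (n + i) = Wait (mkseq a j) i.
  elim: i => [|i IH] ij; first by rewrite addn0.
  by rewrite addnS /= IH ?(ltnW ij)//= size_mkseq ltn_eqF.
(* Reading [a j] zeros and two ones leads to the next node: the first one forks, the second one
   descends. *)
exists (n + a j).+2 => /=;
  first by rewrite ltnS (leq_trans jn)// leqW// leq_addr.
by rewrite wait//= size_mkseq eqxx -mkseqS Ta /= -mkseqS.
Qed.

End automaton.

Section tree_martingale.
Variable R : realType.

(** With these two levels the compensating values are 2(1/2) - 3/4 = 1/4 and 2(3/4) - 1/2 = 1, so
    they stay in the unit interval. *)
Definition level (n : nat) : R := if odd n then 3 / 4 else 1 / 2.

(** The value at [Dead t true] is forced by the mean at [Fork t k], whose other successor is one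
    level deeper. *)
Definition value (st : state) : R :=
  match st with
  | Wait t _ | Fork t _ | Dead t false => level (size t)
  | Dead t true => 2 * level (size t) - level (size t).+1
  end.

Lemma value_itv st : 0 <= value st <= 1.
Proof.
by case: st => [t k|t k|t []] /=; rewrite /level /=; case: odd => /=; lra.
Qed.

Lemma value_step T st : value st = (value (step T st false) + value (step T st
  true)) / 2.
Proof.
case: st => [t k|t k|t c] /=; last first.
- by case: c => /=; lra.
- by rewrite size_rcons; lra.
by case: ifP => _ /=; lra.
Qed.

Definition tree_martingale (T : seq nat -> bool) : tree_functions R :=
  fun s => clamp (value (run T s)).

Lemma tree_martingaleE T s : \val (tree_martingale T s) = value (run T s).
Proof.
have /andP[v0 v1] := value_itv (run T s).
by rewrite /tree_martingale /= (min_idPr v1) (max_idPr v0).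
Qed.

Lemma martingale_tree_martingale T : martingale (tree_martingale T).
Proof.
by move=> s; rewrite !tree_martingaleE /run !foldl_rcons -value_step.
Qed.

Lemma cvgn_eventually_constant (u : nat -> R) N :
  (forall n, (N <= n)%N -> u n = u N) -> cvgn u.
Proof.
move=> uN; apply/cvgn_cauchyP => k; exists N => i j Ni Nj.
by rewrite !uN// subrr normr0 invr_gt0.
Qed.

(** An infinite branch produces both levels arbitrarily late. Conversely, if the values along [b] do
    not converge they never become constant, so the run never dies, its value depends on the depth
    alone, and the depth grows without bound. *)
Lemma tree_martingale_converging T :
  everywhere_converging (tree_martingale T) <->
  ~ exists a : nat -> nat, forall j, T (mkseq a j.+1).
Proof.
split=> [cv [a Ta]|wf b].
  (* Tolerance 1/4 is exactly the gap between the two levels, and the Cauchy bound is strict; depths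
     [N.*2] and [N.*2.+1] have opposite parities. *)
  have /cvgn_cauchyP/(_ 3%N)[N NP] := cv (fun i => follow a (orbit T a i)).
  have [m Nm mE] := orbit_branch Ta N.*2.
  have [n Nn nE] := orbit_branch Ta N.*2.+1.
  have N2 : (N <= N.*2)%N by rewrite -addnn leq_addr.
  have := NP n m (leq_trans (leqW N2) Nn) (leq_trans N2 Nm).
  rewrite !tree_martingaleE !run_orbit {}mE {}nE.
  have vE t k : value (Wait t k) = level (size t) by [].
  rewrite !vE !size_mkseq /level /= odd_double /=.
  by rewrite ger0_norm => [?|]; lra.
apply: contrapT => ncv; apply: wf; apply: (@run_branch T b).
pose v n := value (run T (mkseq b n)).
have vN N : exists2 n, (N <= n)%N & v n != v N.
  apply: contrapT => vc; apply: ncv;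
    apply: (@cvgn_eventually_constant _ N) => n Nn.
  rewrite !tree_martingaleE; apply/eqP/negPn/negP => nN; apply: vc; by exists n.
have dead N n t c : run T (mkseq b N) = Dead t c -> (N <= n)%N ->
    run T (mkseq b n) = Dead t c.
  move=> NE; elim: n => [|n IH]; first by rewrite leqn0 => /eqP <-.
  by rewrite leq_eqVlt => /predU1P[<-//|Nn]; rewrite run_mkseqS IH.
have alive n : v n = level (size (trace (run T (mkseq b n)))).
  rewrite /v; case E : (run T (mkseq b n)) => [//|//|t c].
  have [m nm] := vN n; rewrite /v E (dead _ _ _ _ E nm) eqxx //.
elim => [|j [n jn]]; first by exists 0%N.
have [m nm mn] := vN n; exists m; apply: leq_ltn_trans jn _.
rewrite ltn_neqAle size_prefix ?run_prefix// andbT.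
by apply: contraNneq mn => mn; rewrite !alive mn.
Qed.

(** A run on a fixed word queries finitely many nodes, so each coordinate is locally constant in
    [z]. *)
Lemma tree_martingale_continuous (Z : topologicalType) (T : Z -> seq nat ->
  bool) :
  (forall t, continuous (fun z => T z t)) ->
  continuous (fun z => tree_martingale (T z)).
Proof.
move=> cT z; apply: prod_topology_cvg => s A /nbhs_singleton As.
have : \forall z' \near z, run (T z') s = run (T z) s.
  elim/last_ind: s {A As} => [|s b IH]; first exact: nearW.
  have runS z' : run (T z') (rcons s b) = step (T z') (run (T z') s) b.
    by rewrite /run foldl_rcons.
  have Tb st : \forall z' \near z, step (T z') st b = step (T z) st b.
    case: st => [t k|t k|t c]; [|exact: nearW|exact: nearW].
    have : nbhs z [set z' | T z' (rcons t k) = T z (rcons t k)].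
      exact: (cT (rcons t k) z _ (discrete_set1 _)).
    by apply: filterS => z' /= ->.
  by apply: filterS2 IH (Tb (run (T z) s)) => z' rz tz; rewrite !runS rz.
by apply: filterS => z' rz; rewrite /= /tree_martingale rz.
Qed.

End tree_martingale.

(** * Trees of closed sets *)

Lemma all_continuous (Z : topologicalType) (I : Type) (c : I -> Z -> bool) (l :
  seq I) :
  (forall i, continuous (c i)) -> continuous (fun z => all (c^~ z) l).
Proof.
move=> cc; elim: l => [|i l IH] /=; first by move=> z; exact: cvg_cst.
apply: (@discrete_family_continuous Z bool bool (c i) (fun b z => b && all (c^~
  z) l)) => // b.
exact: (@discrete_comp_continuous Z bool bool _ (andb b)).
Qed.

(** The natural section tree of [F] at [z] need not depend continuously on [z]. Here a node is
    discarded only when a bounded search finds [z] in an open set [O] attached to one of its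
    prefixes; this delays the rejection but keeps the same infinite branches. *)
Lemma closed_tree (R : realType) (Z : topologicalType) (F : set (Z *
  baire_space)) :
  zero_dimensional_polish R Z -> closed F ->
  exists2 T : Z -> seq nat -> bool, forall t, continuous (fun z => T z t) &
    forall z, (exists a, F (z, a)) <-> exists a, forall j, T z (mkseq a j.+1).
Proof.
move=> [pZ bZ] cF.
pose O (t : seq nat) : set Z :=
  [set z | forall a, mkseq a (size t) = t -> ~ F (z, a)]°.
have /choice[V VO] : forall t, exists V : nat -> set Z,
    (forall n, clopen (V n)) /\ O t = \bigcup_n V n.
  by move=> t; apply: (open_bigcup_clopen pZ bZ); exact: open_interior.
(* All prefixes of [t] are tested against the first [(size t).+1] clopen pieces, a finite and hence
   clopen condition on [z]. *)
pose T z t := all (fun j => all (fun i => ~~ `[< V (take j t) i z >])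
  (iota 0 (size t).+1)) (iota 0 (size t).+1).
exists T.
  move=> t; apply: all_continuous => j; apply: all_continuous => i.
  apply: (@discrete_comp_continuous Z bool bool _ negb); apply: clopen_asbool.
  by have [] := VO (take j t).
move=> z; split=> [[a Fa]|[a Ta]]; exists a.
  move=> n; apply/allP => j; rewrite mem_iota add0n => /andP[_];
    rewrite size_mkseq => jn.
  apply/allP => i _; apply/negP => /asboolP Vz.
  have : O (take j (mkseq a n.+1)) z by rewrite (VO _).2; exists i.
  move=> /interior_subset/(_ a); apply => //.
  rewrite size_takel ?size_mkseq//; rewrite ltnS in jn.
  by rewrite /mkseq -map_take take_iota (minn_idPl jn).
apply: contrapT => nF.
have : nbhs ((z, a) : Z * baire_space) (~` F) by apply: open_nbhs_nbhs;
  split => //; exact: closed_openC.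
move=> [[W B] /= [Wz /(@nbhs_cylinder nat)[n nB]] WB].
have : O (mkseq a n) z.
  apply: filterS Wz => z' Wz' a'; rewrite size_mkseq => a'a.
  by apply: (WB (z', a')); split => //; exact: nB.
rewrite (VO _).2 => -[i _ Vz].
(* Long enough for the test at [s] to include both the prefix of length [n] and the piece of index
   [i]. *)
pose s := mkseq a (maxn n i).+1.
have sz : size s = (maxn n i).+1 by rewrite size_mkseq.
have Ts : forall k, (k < (size s).+1)%N -> forall l, (l < (size s).+1)%N ->
    ~~ `[< V (take k s) l z >].
  move=> k ks l ls; have /allP/(_ k) := Ta (maxn n i).
  by rewrite mem_iota add0n => /(_ ks) /allP/(_ l);
    rewrite mem_iota add0n => /(_ ls).
have ns : (n < (size s).+1)%N by rewrite sz ltnS leqW// leq_maxl.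
have ims : (i < (size s).+1)%N by rewrite sz ltnS leqW// leq_maxr.
apply: (negP (Ts n ns i ims)); apply/asboolP.
by rewrite /s /mkseq -map_take take_iota (minn_idPl _)// leqW ?leq_maxl.
Qed.

Lemma Cset0_complete (R : realType) (Z : topologicalType) (D : set Z) :
  zero_dimensional_polish R Z -> Pi1 1 D ->
  exists2 g : Z -> Pspace R 0, continuous g & D = g @^-1` @Cset R 0.
Proof.
move=> zZ [F cF DF]; have [T cT TF] := closed_tree zZ cF.
exists (fun z => tree_martingale R (T z));
  first exact: tree_martingale_continuous.
have DE z : D z <-> ~ exists a, F (z, a).
  rewrite -[D]setCK DF; split=> [nF [a Fa]|nF [[z' a] Fa /= zE]].
    by apply: nF; exists (z, a).
  by apply: nF; exists a; rewrite -zE.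
apply/seteqP; split=> z.
  move=> /DE nF; split; first exact: martingale_tree_martingale.
  by apply/tree_martingale_converging; rewrite -TF.
by move=> [_ /tree_martingale_converging]; rewrite -TF => /DE.
Qed.

(** * Completeness and universality *)

Lemma Cset_complete (R : realType) n (Z : topologicalType) (D : set Z) :
  zero_dimensional_polish R Z -> Pi1 n.+1 D ->
  exists2 g : Z -> Pspace R n, continuous g & D = g @^-1` @Cset R n.
Proof.
elim: n Z D => [|n IH] Z D zZ nD; first exact: Cset0_complete.
have [B nB DB] := nD.
have [g cg gE] := IH _ _ (zdp_prod_cantor zZ) (Pi1_decode zZ nB).
have [b cb bE] := @curry_continuous (Pspace R n) Z g cg.
have gP z x : Cset (g (z, x)) <-> exists2 a, codes x a & B (z, a).
  by rewrite -[Cset _]/((g @^-1` @Cset R n) (z, x)) -gE.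
exists b => //; rewrite -[D]setCK DB; apply/seteqP; split=> z /= nz.
  move=> x; rewrite -[X in Cset X]/((b z : continuousType _ _) x) bE.
  by move=> /gP[a _ Bza]; apply: nz; exists (z, a).
move=> [[z' a] Bza /= zE]; rewrite zE in Bza.
have [x xa] := codes_ex a; apply: (nz x).
by rewrite -[X in Cset X]/((b z : continuousType _ _) x) bE; apply/gP; exists a.
Qed.

Lemma Cset_Pi1 (R : realType) n : Pi1 n.+1 (@Cset R n).
Proof.
elim: n => [|n IH]; first exact: Cset0_Pi1.
exact: (@Pi1_cantor_coprojection n.+1 (Pspace R n.+1) (Pspace R n) _ _
  (@eval_continuous (Pspace R n)) IH).
Qed.

(** The sets with a Borel preimage form a sigma-algebra containing the open sets. *)
Lemma continuous_borel_map (X Y : topologicalType) (f : X -> Y) :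
  continuous f -> borel_map f.
Proof.
move=> cf V bV; apply: (bV [set V | borel (f @^-1` V)]); split.
- split=> /=.
  + exact: sigma_algebra0.
  + move=> A bA; rewrite setTD preimage_setC -setTD.
    exact: sigma_algebraCD.
  + by move=> F bF; rewrite preimage_bigcup; exact: sigma_algebra_bigcup.
- move=> U oU; apply: sub_sigma_algebra; exact: open_comp.
Qed.

Theorem theorem1p7 (R : realType) (n : nat) :
  uniformly_universal R (Pi1 n.+1) (@Uset R n) /\
  class_complete R (Pi1 n.+1) (@Cset R n).
Proof.
have pP m : polish R (Pspace R m).
  by apply: polish_uniform_polish; exact: (Pspace_polish_uniform R m).1.
have CP := Cset_Pi1 R n.
split; last first.
  by split=> // Z pZ bZ D nD; apply: Cset_complete.
have UP : Pi1 n.+1 (@Uset R n) :=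
  Pi1_preimage (@eval_continuous (Pspace R n)) CP.
have zC := zdp_cantor R.
split; first split => //.
- exact: zC.1.
- apply/seteqP; split => [A nA|_ [h _ <-]].
    (* A reduction of [A] is itself a point of [Pspace R n.+1], and the section of [Uset] there is
       [A]. *)
    have [g cg ->] := Cset_complete zC nA.
    exists (mkcts cg : continuousType cantor_space (Pspace R n)) => //.
    by apply/seteqP; split => x; rewrite /xsection /= inE.
  rewrite (_ : xsection _ _ = (h : continuousType cantor_space (Pspace R n))
    @^-1` @Cset R n).
    by apply: Pi1_preimage CP; exact: cts_fun.
  by apply/seteqP; split => x; rewrite /xsection /= inE.
move=> S nS.
have [g cg SE] := Cset_complete (zdp_prod_cantor (zdp_baire R)) nS.
have [b cb bE] := @curry_continuous (Pspace R n) baire_space g cg.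
exists b; first exact: continuous_borel_map.
move=> a; rewrite SE; apply/seteqP; split => x;
  rewrite /xsection /= !inE /Uset /=; by rewrite -bE.
Qed.
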